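(* Let $\mathcal{A}$ be a $d$-coned generic arrangement of $k$ hyperplanes in $\mathbb{P}^n$. Then the dimension of the moduli space $\mathcal{M}_{\mathcal{A}}$ of arrangements combinatorially equivalent to $\mathcal{A}$ is $$D=(d+1)(n-d)+k(n-d-1).$$
   Context: All varieties are over $\mathbb{C}$. A hyperplane arrangement in $\mathbb{P}^n$ is a finite unordered set $\mathcal{A}=\{H_1,\ldots,H_k\}$ of distinct hyperplanes. Its intersection lattice $\mathcal{L}(\mathcal{A})$ is the poset of all intersections $H_{i_1}\cap\cdots\cap H_{i_t}$ ordered by reverse inclusion ($B\le C\iff C\subseteq B$). Two arrangements in $\mathbb{P}^n$ are combinatorially equivalent if their intersection lattices are isomorphic, i.e. there is a bijection between their hyperplanes inducing an order isomorphism of the lattices. $\mathcal{M}_{\mathcal{A}}$ is the set of arrangements in $\mathbb{P}^n$ combinatorially equivalent to $\mathcal{A}$, regarded as a subset of the quotient $(\mathbb{P}^{n*})^k/\mathcal{S}_k$ of the product of dual projective spaces by the symmetric group permuting the factors (an arrangement is identified with the orbit of its orderings), with the topology induced from the Zariski topology. An arrangement of $k$ hyperplanes in $\mathbb{P}^m$ is generic if $k>m$ and no point lies in more than $m$ of the hyperplanes. A $d$-coned generic arrangement in $\mathbb{P}^n$ is an arrangement $\mathcal{A}$ of $k>n$ hyperplanes for which there are a linear subspace $H\cong\mathbb{P}^{n-(d+1)}$ of $\mathbb{P}^n$, a generic hyperplane arrangement $\mathcal{B}$ in $H$, and a linear subspace $\Omega$ of dimension $d$ disjoint from $H$, such that $\mathcal{A}$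 consists of the linear spans of $\Omega$ with the hyperplanes of $\mathcal{B}$. *)

(* Defs.v *)
From HB Require Import structures.
From mathcomp Require Import -(notations) mpoly.
From mathcomp Require Import all_boot all_order all_algebra all_fingroup.
From mathcomp Require Import generic_quotient finmap.
From mathcomp Require Import boolp classical_sets functions topology.

Set Implicit Arguments.
Unset Strict Implicit.
Unset Printing Implicit Defensive.

Import GRing.Theory.

Local Open Scope classical_set_scope.
Local Open Scope quotient_scope.
Local Open Scope ring_scope.

(* P^n over F is the space of lines of 'rV[F]_n.+1.  A linear subspace of P^n
   is given by the vector subspace it is the projectivization of, so its
   projective dimension is one less than its \dim. *)
Record hyperplane (F : fieldType) (n : nat) := Hyperplane {
  hyp_space :> {vspace 'rV[F]_n.+1};
  _ : \dim hyp_space == n }.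

HB.instance Definition _ (F : fieldType) (n : nat) :=
  [isSub for @hyp_space F n].
HB.instance Definition _ (F : fieldType) (n : nat) :=
  [Choice of hyperplane F n by <:].

Definition intersection (F : fieldType) (n : nat)
    (S : {fset hyperplane F n}) : {vspace 'rV[F]_n.+1} :=
  (\bigcap_(H <- S) hyp_space H)%VS.

(* The intersection of the empty subfamily, the whole space, is included. *)
Definition intersection_lattice (F : fieldType) (n : nat)
    (A : {fset hyperplane F n}) : set {vspace 'rV[F]_n.+1} :=
  [set intersection S | S in [set S | (S `<=` A)%fset]].

Definition lattice_le (F : fieldType) (n : nat)
    (U W : {vspace 'rV[F]_n.+1}) : bool := (W <= U)%VS.

Definition combinatorially_equivalent (F : fieldType) (n : nat)
    (A B : {fset hyperplane F n}) : Prop :=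
  exists (s : hyperplane F n -> hyperplane F n)
         (phi : {vspace 'rV[F]_n.+1} -> {vspace 'rV[F]_n.+1}),
  [/\ set_bij [set` A] [set` B] s,
      set_bij (intersection_lattice A) (intersection_lattice B) phi,
      (forall U W, intersection_lattice A U -> intersection_lattice A W ->
         lattice_le (phi U) (phi W) = lattice_le U W)
    & forall S : {fset hyperplane F n}, (S `<=` A)%fset ->
         phi (intersection S) = intersection [fset s H | H in S]%fset].

(* B is a generic arrangement in the projective space P(H) of dimension
   (\dim H).-1; the points of P(H) are represented by nonzero vectors. *)
Definition generic_arrangement_in (F : fieldType) (n : nat)
    (H : {vspace 'rV[F]_n.+1}) (B : {fset {vspace 'rV[F]_n.+1}}) : Prop :=
  exists m : nat,
  [/\ \dim H = m.+1,
      (forall U, U \in B -> (U <= H)%VS /\ \dim U = m),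
      (m < #|` B|)%N
    & forall v, v != 0 -> v \in H ->
        (#|` [fset U in B | v \in U]%fset| <= m)%N].

Definition coned_generic (F : fieldType) (n d : nat)
    (A : {fset hyperplane F n}) : Prop :=
  (n < #|` A|)%N /\
  exists (H Omega : {vspace 'rV[F]_n.+1}) (B : {fset {vspace 'rV[F]_n.+1}}),
  [/\ (\dim H + d)%N = n,
      \dim Omega = d.+1,
      (H :&: Omega)%VS = 0%VS,
      generic_arrangement_in H B
    & [fset hyp_space K | K in A]%fset = [fset (Omega + U)%VS | U in B]%fset].

(* The product (P^{n*})^k: a point of the dual projective space P^{n*} is
   a hyperplane of P^n. *)
Definition hyperplanes (F : fieldType) (n k : nat) : Type :=
  {ffun 'I_k -> hyperplane F n}.
HB.instance Definition _ (F : fieldType) (n k : nat) :=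
  Choice.on (hyperplanes F n k).

(* Row i of a is a vector of homogeneous coordinates of H i in P^{n*}. *)
Definition coordinates (F : fieldType) (n k : nat) (H : hyperplanes F n k)
    (a : 'M[F]_(k, n.+1)) : Prop :=
  forall i, row i a != 0 /\
    forall x : 'rV[F]_n.+1, (x \in hyp_space (H i)) = (x *m (row i a)^T == 0).

(* The polynomial ring in the k * n.+1 variables x_(i, j); the variable
   x_(i, j) has index [mxvec_index i j]. *)
Notation multipoly F n k := (mpoly (k * n.+1) F).

Definition multihomogeneous (F : fieldType) (n k : nat)
    (p : multipoly F n k) : Prop :=
  exists e : 'I_k -> nat, forall m, m \in msupp p ->
    forall i, (\sum_(j < n.+1) m (mxvec_index i j))%N = e i.

Definition eval_at (F : fieldType) (n k : nat) (a : 'M[F]_(k, n.+1))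
    (p : multipoly F n k) : F :=
  meval (fun l => mxvec a 0 l) p.

Definition zero_locus (F : fieldType) (n k : nat)
    (P : set (multipoly F n k)) : set (hyperplanes F n k) :=
  [set H | forall p a, P p -> coordinates H a -> eval_at a p = 0].

Definition zariski_closed (F : fieldType) (n k : nat)
    (Z : set (hyperplanes F n k)) : Prop :=
  exists2 P : set (multipoly F n k),
    P `<=` @multihomogeneous F n k & Z = zero_locus P.

Definition zariski_open (F : fieldType) (n k : nat)
    (U : set (hyperplanes F n k)) : Prop := zariski_closed (~` U).

Lemma coordinates_exist (F : fieldType) (n k : nat) (H : hyperplanes F n k) :
  exists a, coordinates H a.
Proof.
have hyp_coord (U : hyperplane F n) : exists c : 'rV[F]_n.+1, c != 0 /\
    forall x : 'rV[F]_n.+1, (x \in hyp_space U) = (x *m c^T == 0).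
  pose M := \matrix_(i < n) tnth (vbasis U) (cast_ord (esym (eqP (valP U))) i).
  have: kermx M^T != 0.
    by rewrite kermx_eq0 /row_free neq_ltn ltnS (leq_trans (rank_leq_col _)).
  case/rowV0Pn => c /sub_kermxP cM c0; exists c; split => //.
  have cM' : M *m c^T = 0 by rewrite -[LHS]trmxK trmx_mul trmxK cM trmx0.
  pose f : 'Hom('rV[F]_n.+1, 'M[F]_1) := linfun (mulmxr c^T).
  have fE x : f x = x *m c^T by rewrite lfunE.
  have sub : (hyp_space U <= lker f)%VS.
    rewrite -(span_basis (vbasisP U)); apply/span_subvP => u.
    move=> /tnthP[i ->]; rewrite memv_ker fE.
    have -> : tnth (vbasis U) i = row (cast_ord (eqP (valP U)) i) M.
      rewrite rowK; congr (tnth _ _); exact: val_inj.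
    by rewrite -row_mul cM' row0.
  have eqU : hyp_space U = lker f.
    apply/eqP; rewrite eqEdim sub (eqP (valP U)) /=.
    have [j cj] : exists j, c 0 j != 0.
      apply/existsP; apply: contraNT c0 => /existsPn h; apply/eqP/rowP => j.
      by have := h j; rewrite negbK mxE => /eqP.
    have kerN : lker f != fullv.
      apply: contraNneq cj => kf.
      have : delta_mx 0 j \in lker f by rewrite kf memvf.
      rewrite memv_ker fE => /eqP/matrixP/(_ 0 0).
      by rewrite -rowE !mxE => ->.
    have : (\dim (lker f) < \dim {:'rV[F]_n.+1})%N.
      rewrite (ltn_leqif (dimv_leqif_sup (subvf _))).
      by apply: contraNN kerN => kf; rewrite eqEsubv subvf.
    by rewrite dimvf /dim /= mul1n ltnS.
  by move=> x; rewrite eqU memv_ker fE.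
pose g i := projT1 (cid (hyp_coord (H i))).
exists (\matrix_i g i) => i; rewrite rowK.
exact: (projT2 (cid (hyp_coord (H i)))).
Qed.

Lemma coordinates_unique (F : fieldType) (n k : nat) (H : hyperplanes F n k)
    (a b : 'M[F]_(k, n.+1)) :
  coordinates H a -> coordinates H b ->
  exists2 l : 'I_k -> F, forall i, l i != 0 & forall i j, b i j = l i * a i j.
Proof.
move=> Ha Hb.
suff h i : exists l : F, l != 0 /\ forall j, b i j = l * a i j.
  exists (fun i => projT1 (cid (h i))) => i;
  by case: (projT2 (cid (h i))).
have [a0 aE] := Ha i; have [b0 bE] := Hb i.
have [j aj] : exists j, a i j != 0.
  apply/existsP; apply: contraNT a0 => /existsPn h; apply/eqP/rowP => j.
  by have := h j; rewrite negbK !mxE => /eqP.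
have E j' : b i j' = b i j / a i j * a i j'.
  pose x := delta_mx 0 j' - (a i j' / a i j) *: delta_mx 0 j : 'rV[F]_n.+1.
  have evx (c : 'M[F]_(k, n.+1)) :
      x *m (row i c)^T = (c i j' - a i j' / a i j * c i j)%:M.
    rewrite mulmxBl -scalemxAl -!rowE; apply/matrixP => s t.
    by rewrite !ord1 !mxE eqxx mulr1n.
  have : x *m (row i a)^T == 0 by rewrite evx divfK // subrr raddf0.
  rewrite -aE bE evx => /eqP/matrixP/(_ 0 0); rewrite !mxE mulr1n => /eqP.
  by rewrite subr_eq0 => /eqP ->; rewrite mulrAC [RHS]mulrAC (mulrC (b i j)).
exists (b i j / a i j); split => //.
apply: contraNneq b0 => l0; apply/eqP/rowP => j'.
by rewrite !mxE E l0 mul0r.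
Qed.

Lemma eval_at_coordinates (F : fieldType) (n k : nat) (H : hyperplanes F n k)
    (a b : 'M[F]_(k, n.+1)) (p : multipoly F n k) :
  coordinates H a -> coordinates H b -> multihomogeneous p ->
  eval_at a p = 0 -> eval_at b p = 0.
Proof.
move=> Ha Hb [e pe] pa; have [l l0 bE] := coordinates_unique Ha Hb.
suff -> : eval_at b p = (\prod_i l i ^+ e i) * eval_at a p by rewrite pa mulr0.
rewrite /eval_at !mevalE mulr_sumr big_seq [RHS]big_seq; apply: eq_bigr => m mp.
rewrite mulrCA; congr (_ * _).
have reidx (c : 'M[F]_(k, n.+1)) :
    \prod_t mxvec c 0 t ^+ m t = \prod_i \prod_j c i j ^+ m (mxvec_index i j).
  rewrite pair_bigA /= (reindex _ (curry_mxvec_bij _ _)) /=.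
  by apply: eq_bigr => -[i j] _ /=; rewrite mxvecE.
rewrite !reidx.
rewrite -big_split /=; apply: eq_bigr => i _.
rewrite -(pe m mp i).
rewrite -prodrXr -big_split /=; apply: eq_bigr => j _.
by rewrite bE exprMn.
Qed.

Lemma multihomogeneousM (F : fieldType) (n k : nat) (p q : multipoly F n k) :
  multihomogeneous p -> multihomogeneous q -> multihomogeneous (p * q).
Proof.
move=> [e pe] [f qf]; exists (fun i => e i + f i)%N => m /msuppM_le.
case/allpairsP => -[m1 m2] /= [/pe h1 /qf h2 ->] i.
by rewrite -h1 -h2 -big_split; apply: eq_bigr => j _; rewrite mnmDE.
Qed.

Lemma zariski_openT (F : fieldType) (n k : nat) :
  @zariski_open F n k setT.
Proof.
exists [set 1].
  move=> _ ->; exists (fun=> 0%N) => m; rewrite msupp1 inE => /eqP -> i.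
  by rewrite big1 // => j _; rewrite mnm0E.
rewrite setCT; apply/esym; rewrite -subset0 => H /= h.
have [a Ha] := coordinates_exist H.
by have := h 1 a erefl Ha; rewrite /eval_at meval1 => /eqP; rewrite oner_eq0.
Qed.

Lemma zariski_openI (F : fieldType) (n k : nat) :
  setI_closed (@zariski_open F n k).
Proof.
move=> U W [P Ph PU] [Q Qh QW].
exists [set r | exists p q, [/\ P p, Q q & r = p * q]].
  by move=> _ [p [q [/Ph hp /Qh hq ->]]]; exact: multihomogeneousM.
rewrite setCI PU QW; apply/seteqP; split => H.
  move=> [h|h] _ a [p [q [Pp Qq ->]]] Ha; rewrite /eval_at mevalM.
    by rewrite [X in X * _](h p a Pp Ha) mul0r.
  by rewrite [X in _ * X](h q a Qq Ha) mulr0.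
move=> h; have [hP|nP] := pselect (zero_locus P H); [by left|right].
move=> q b Qq Hb; apply/eqP; apply: contrapT => /negP qb; apply: nP.
move=> p a Pp Ha; apply: (eval_at_coordinates Hb Ha (Ph _ Pp)).
have := h (p * q) b; rewrite /eval_at mevalM => /(_ _ Hb)/eqP.
rewrite mulf_eq0 (negPf qb) orbF => hp; apply/eqP/hp; by exists p, q.
Qed.

Lemma zariski_open_bigcup (F : fieldType) (n k : nat) (I : Type)
    (U : I -> set (hyperplanes F n k)) :
  (forall i, zariski_open (U i)) -> zariski_open (\bigcup_i U i).
Proof.
move=> h; exists [set p | multihomogeneous p /\
    exists i, ~` U i `<=` zero_locus [set p]]; first by move=> p [].
rewrite setC_bigcup; apply/seteqP; split => H.
  by move=> hH p a [_ [i]] /(_ H (hH i Logic.I)) + Ha; apply.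
move=> hH i _; have [P Ph PU] := h i; rewrite PU => p a Pp Ha.
apply: (hH p a) => //; split; first exact: Ph.
by exists i; rewrite PU => K hK _ b -> Hb; exact: hK.
Qed.

(* The Zariski topology on (P^{n*})^k. *)
HB.instance Definition _ (F : fieldType) (n k : nat) :=
  isOpenTopological.Build (hyperplanes F n k)
    (@zariski_openT F n k) (@zariski_openI F n k)
    (@zariski_open_bigcup F n k).

Definition same_orbit (F : fieldType) (n k : nat)
    (H K : hyperplanes F n k) : bool :=
  [exists s : 'S_k, K == [ffun i => H (s i)]].

Lemma same_orbit_refl (F : fieldType) (n k : nat) :
  reflexive (@same_orbit F n k).
Proof.
by move=> H; apply/existsP; exists 1%g; apply/eqP/ffunP => i; rewrite ffunE perm1.
Qed.

Lemma same_orbit_sym (F : fieldType) (n k : nat) :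
  symmetric (@same_orbit F n k).
Proof.
have h (H K : hyperplanes F n k) : same_orbit H K -> same_orbit K H.
  case/existsP => s /eqP ->; apply/existsP; exists s^-1%g.
  by apply/eqP/ffunP => i; rewrite !ffunE permKV.
by move=> H K; apply/idP/idP; exact: h.
Qed.

Lemma same_orbit_trans (F : fieldType) (n k : nat) :
  transitive (@same_orbit F n k).
Proof.
move=> K H L /existsP[s /eqP ->] /existsP[t /eqP ->]; apply/existsP.
by exists (t * s)%g; apply/eqP/ffunP => i; rewrite !ffunE permM.
Qed.

Definition orbit_equiv (F : fieldType) (n k : nat) :
    equiv_rel (hyperplanes F n k) :=
  EquivRel (@same_orbit F n k) (@same_orbit_refl F n k)
    (@same_orbit_sym F n k) (@same_orbit_trans F n k).

(* (P^{n*})^k / S_k with the quotient topology. *)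
Definition unordered_hyperplanes (F : fieldType) (n k : nat) : topologicalType :=
  quotient_topology {eq_quot orbit_equiv F n k}.

Definition orbit_of (F : fieldType) (n k : nat) (H : hyperplanes F n k) :
    unordered_hyperplanes F n k :=
  (\pi_({eq_quot orbit_equiv F n k}) H).

Definition is_ordering (F : fieldType) (n k : nat)
    (B : {fset hyperplane F n}) (H : hyperplanes F n k) : Prop :=
  injective H /\ forall K, K \in B <-> exists i, H i = K.

Definition moduli_space (F : fieldType) (n : nat) (A : {fset hyperplane F n}) :
    set (unordered_hyperplanes F n #|` A|) :=
  [set x | exists (B : {fset hyperplane F n}) (H : hyperplanes F n #|` A|),
     [/\ combinatorially_equivalent A B, is_ordering B H & x = orbit_of H]].
Arguments moduli_space {F n} A _.

Definition irreducible (T : topologicalType) (Z : set T) : Prop :=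
  Z !=set0 /\
  forall Z1 Z2 : set T, closed Z1 -> closed Z2 ->
    Z `<=` Z1 `|` Z2 -> Z `<=` Z1 \/ Z `<=` Z2.

Definition irreducible_chain (T : topologicalType) (l : nat)
    (Z : 'I_l.+1 -> set T) : Prop :=
  (forall i, closed (Z i) /\ irreducible (Z i)) /\
  (forall i j : 'I_l.+1, (i < j)%N -> Z i `<` Z j).

(* T has Krull dimension D; the empty space has no dimension in nat. *)
Definition has_dimension (T : topologicalType) (D : nat) : Prop :=
  (exists Z : 'I_D.+1 -> set T, irreducible_chain Z) /\
  (forall (l : nat) (Z : 'I_l.+1 -> set T), irreducible_chain Z -> (l <= D)%N).

(* Main.v *)
(* An ordering of an arrangement equivalent to A is a tuple of k hyperplanes any
   m+1 of which, with m = n-d-1, meet in one and the same subspace of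
   codimension m+1: combinatorial equivalence preserves the dimensions of all
   intersections, and these determine the lattice.  In coordinates, the tuple
   is a k x (n+1) matrix of rank m+1 whose rows are in general position in their
   span, so locally it is a product C * B in which B contains an identity block
   and each row of C has one entry equal to 1; this leaves
   D = (m+1)(n-m) + km free entries.

   Upper bound.  A chain of irreducible closed subsets of the quotient by S_k
   lifts to a chain upstairs.  Multihomogeneous polynomials f_1, ..., f_l, with
   f_i vanishing on the (i-1)-st member but not on the i-th one, are
   algebraically independent on the last member: a relation restricts to the
   previous member by setting f_l = 0, and f_l can be cancelled on an
   irreducible set.  In the chart the N^l monomials in the f_i with exponents
   below N are polynomials of degree O(N) in D variables, whence l <= D.

   Lower bound.  Free the entries of B and then those of C one at a time,
   starting from a Vandermonde matrix C.  Each locus is irreducible because two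
   of its points lie on the image of a line, and the newly freed entry is a
   polynomial in the normalized coordinates that is constant on the previous
   locus. *)

Require Import Defs.
From mathcomp Require Import -(notations) mpoly.
From mathcomp Require Import all_boot all_order all_algebra all_fingroup.
From mathcomp Require Import generic_quotient finmap.
From mathcomp Require Import boolp classical_sets functions cardinality topology reals.
From mathcomp Require Import complex.

Set Implicit Arguments.
Unset Strict Implicit.
Unset Printing Implicit Defensive.

Import Order.TTheory GRing.Theory Num.Theory.

Local Open Scope classical_set_scope.
Local Open Scope ring_scope.

(** * Multihomogeneous polynomials and normalized coordinates *)

Lemma prod_mxvec (R : comNzRingType) (k l : nat) (f : 'I_(k * l) -> R) :
  \prod_t f t = \prod_i \prod_j f (mxvec_index i j).
Proof.
rewrite pair_bigA /= (reindex _ (curry_mxvec_bij _ _)) /=.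
by apply: eq_bigr => -[i j].
Qed.

Section Evaluation.
Context (F : fieldType) (n k : nat).
Implicit Types (a : 'M[F]_(k, n.+1)) (p q : multipoly F n k) (m : multinom (k * n.+1)).

Lemma eval_atD a p q : eval_at a (p + q) = eval_at a p + eval_at a q.
Proof. exact: mevalD. Qed.

Lemma eval_atM a p q : eval_at a (p * q) = eval_at a p * eval_at a q.
Proof. exact: mevalM. Qed.

Lemma eval_at1 a : eval_at a 1 = 1.
Proof. exact: meval1. Qed.

Lemma eval_atX a p e : eval_at a (p ^+ e) = eval_at a p ^+ e.
Proof. by elim: e => [|e IH]; rewrite ?eval_at1 // !exprS eval_atM IH. Qed.

Lemma eval_at_sum a (I : Type) (r : seq I) (P : pred I) (G : I -> multipoly F n k) :
  eval_at a (\sum_(i <- r | P i) G i) = \sum_(i <- r | P i) eval_at a (G i).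
Proof. exact: raddf_sum. Qed.

Lemma eval_atZ a c p : eval_at a (c *: p) = c * eval_at a p.
Proof. exact: mevalZ. Qed.

Lemma eval_at_mpolyX a m :
  eval_at a (mpolyX F m) = \prod_i \prod_j a i j ^+ m (mxvec_index i j).
Proof.
rewrite /eval_at mevalX prod_mxvec; apply: eq_bigr => i _.
by apply: eq_bigr => j _; rewrite mxvecE.
Qed.

Lemma eval_at_var a i j : eval_at a (mpolyX F (mnm1 (mxvec_index i j))) = a i j.
Proof. by rewrite /eval_at mevalXU mxvecE. Qed.

(** Pads the degree in each block of variables up to [D] with the variable at [(i, t i)], which
    equals 1 in normalized coordinates. The subtraction does not truncate as long as [D] bounds
    every block degree. *)
Definition homogenized_exponent (t : 'I_k -> 'I_n.+1) (D : nat)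
    (m : multinom (k * n.+1)) : multinom (k * n.+1) :=
  \big[@mnm_add (k * n.+1)/m]_i
     mnm_muln (mnm1 (mxvec_index i (t i)))
       (D - \sum_(j < n.+1) m (mxvec_index i j)).

(** The target degree [msize p] strictly exceeds every block degree, so each monomial keeps at least
    one factor at every [(i, t i)]. Hence the result vanishes as soon as one of these coordinates is
    zero. *)
Definition homogenization (t : 'I_k -> 'I_n.+1) p : multipoly F n k :=
  \sum_(m <- msupp p)
    mcoeff m p *: mpolyX F (homogenized_exponent t (msize p) m).

Lemma homogenized_exponentE t D m i j :
  homogenized_exponent t D m (mxvec_index i j) =
  (m (mxvec_index i j) +
     (j == t i) * (D - \sum_(j < n.+1) m (mxvec_index i j)))%N.
Proof.
have -> : homogenized_exponent t D m (mxvec_index i j) =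
  (\sum_i' (mxvec_index i' (t i') == mxvec_index i j) *
     (D - \sum_(j < n.+1) m (mxvec_index i' j)) + m (mxvec_index i j))%N.
  rewrite /homogenized_exponent.
  elim/big_rec2: _ => // i' x y _ IH; rewrite mnmDE IH mulmnE mnm1E.
  by rewrite addnA.
rewrite addnC; congr addn; rewrite (bigD1 i) //= [X in (_ + X)%N]big1 ?addn0.
  congr (nat_of_bool _ * _)%N; apply/eqP/eqP => [|->//].
  by move/(can_inj (fun x => cast_ordK (mxvec_cast _ _) x))/enum_rank_inj => -[].
move=> i' ni; case: eqP => // /cast_ord_inj/enum_rank_inj[ii'].
by rewrite ii' eqxx in ni.
Qed.

Lemma deg_le_msize m p (i : 'I_k) :
  m \in msupp p -> (\sum_(j < n.+1) m (mxvec_index i j) < msize p)%N.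
Proof.
move=> /msize_mdeg_lt; apply: leq_ltn_trans; rewrite mdegE.
have -> : (\sum_l m l = \sum_(i < k) \sum_(j < n.+1) m (mxvec_index i j))%N.
  rewrite pair_bigA /= (reindex _ (curry_mxvec_bij _ _)) /=.
  by apply: eq_bigr => -[].
by rewrite (bigD1 i) //= leq_addr.
Qed.

Lemma homogenized_degree t D m i :
  (\sum_(j < n.+1) m (mxvec_index i j) <= D)%N ->
  (\sum_(j < n.+1) homogenized_exponent t D m (mxvec_index i j) = D)%N.
Proof.
move=> le_D; under eq_bigr do rewrite homogenized_exponentE.
rewrite big_split /= [X in (_ + X)%N](bigD1 (t i)) //= eqxx mul1n.
by rewrite [X in (_ + (_ + X))%N]big1 => [|j /negPf->//]; rewrite addn0 subnKC.
Qed.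

Lemma homogenization_multihomogeneous t p : multihomogeneous (homogenization t p).
Proof.
exists (fun=> msize p) => m /msupp_sum_le/flatten_mapP[m' /[!mem_filter]/= m'p].
move=> /msuppZ_le /[!msuppX] /[!inE]/eqP-> i.
by rewrite homogenized_degree // ltnW // deg_le_msize.
Qed.

Lemma eval_homogenization t p a :
  (forall i, a i (t i) = 1) -> eval_at a (homogenization t p) = eval_at a p.
Proof.
move=> a1; rewrite /homogenization eval_at_sum [in RHS](mpolyE p) eval_at_sum.
apply: eq_bigr => m _.
rewrite !eval_atZ !eval_at_mpolyX; congr (_ * _); apply: eq_bigr => i _.
apply: eq_bigr => j _; rewrite homogenized_exponentE exprD.
by case: eqP => [->|_]; rewrite ?a1 !(expr1n, expr0, mul0n) mulr1.
Qed.

Lemma eval_homogenization_eq0 t p a i :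
  a i (t i) = 0 -> eval_at a (homogenization t p) = 0.
Proof.
move=> a0; rewrite /homogenization eval_at_sum big_seq big1 // => m mp.
rewrite eval_atZ eval_at_mpolyX (bigD1 i) //= (bigD1 (t i)) //=.
have lt_deg := deg_le_msize i mp.
rewrite homogenized_exponentE a0 eqxx mul1n addnBA; last exact: ltnW.
by rewrite expr0n subn_eq0 leqNgt ltn_addl // !mul0r mulr0.
Qed.

Lemma zero_locus_closed (P : set (multipoly F n k)) :
  P `<=` @multihomogeneous F n k -> closed (zero_locus P).
Proof.
move=> hP; rewrite -openC; exists P => //; exact: setCK.
Qed.

Lemma closed_zero_locus (Z : set (hyperplanes F n k)) : closed Z ->
  exists2 P : set (multipoly F n k),
    P `<=` @multihomogeneous F n k & Z = zero_locus P.
Proof. by rewrite -openC => -[P hP]; rewrite setCK; exists P. Qed.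

Lemma zero_locus1 (H : hyperplanes F n k) a p : coordinates H a ->
  multihomogeneous p -> (zero_locus [set p] H <-> eval_at a p = 0).
Proof.
move=> Ha hp; split=> [h|p0 _ b -> Hb]; first exact: h.
exact: (eval_at_coordinates Ha).
Qed.

Lemma zero_locus1_closed p : multihomogeneous p -> closed (zero_locus [set p]).
Proof. by move=> hp; apply: zero_locus_closed => _ ->. Qed.

Lemma closed_separate (Z : set (hyperplanes F n k)) H : closed Z -> ~ Z H ->
  exists p, [/\ multihomogeneous p, Z `<=` zero_locus [set p]
    & ~ zero_locus [set p] H].
Proof.
move=> /closed_zero_locus[P hP ->] nZ.
have [p /not_implyP[Pp nH]] :
    exists p, ~ (P p -> zero_locus [set p] H).
  by apply/existsNP => h; apply: nZ => p a Pp; apply: h Pp p a erefl.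
by exists p; split => //; [exact: hP|move=> K hK q a ->; exact: hK].
Qed.

Lemma coordinates_scale (H : hyperplanes F n k) a (l : 'I_k -> F) :
  (forall i, l i != 0) -> coordinates H a ->
  coordinates H (\matrix_(i, j) (l i * a i j)).
Proof.
move=> l0 Ha i; have -> : row i (\matrix_(i, j) (l i * a i j)) = l i *: row i a.
  by apply/rowP => j; rewrite !mxE.
have [a0 aE] := Ha i; split; first by rewrite scaler_eq0 negb_or l0.
by move=> x; rewrite aE linearZ /= -scalemxAr scaler_eq0 (negPf (l0 i)).
Qed.

Lemma coordinates_normalize (H : hyperplanes F n k) a (t : 'I_k -> 'I_n.+1) :
  coordinates H a -> (forall i, a i (t i) != 0) ->
  exists2 b, coordinates H b & forall i, b i (t i) = 1.
Proof.
move=> Ha a0; exists (\matrix_(i, j) ((a i (t i))^-1 * a i j)).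
  by apply: (coordinates_scale _ Ha) => i; rewrite invr_eq0.
by move=> i; rewrite mxE mulVf.
Qed.

(** The part of [E] in an affine chart, where arbitrary polynomials, not only multihomogeneous ones,
    have well-defined values. Later [delta] is a maximal minor. *)
Definition normalized_coordinates (t : 'I_k -> 'I_n.+1)
    (delta : multipoly F n k) (E : set (hyperplanes F n k)) :
    set 'M[F]_(k, n.+1) :=
  [set a | exists2 H, E H & [/\ coordinates H a, forall i, a i (t i) = 1
                               & eval_at a delta != 0]].

(** Off the chart the right-hand side is automatic: either [delta] vanishes or some coordinate at
    [(i, t i)] does. Vanishing on the chart thus becomes inclusion in a closed set, to which
    irreducibility applies. *)
Lemma sub_homogenization_locus t delta E p :
  (forall a, normalized_coordinates t delta E a -> eval_at a p = 0) <->
  E `<=` zero_locus [set homogenization t (p * delta)].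
Proof.
have hm := @homogenization_multihomogeneous t (p * delta); split=> [p0 H EH|sE].
  have [a Ha] := coordinates_exist H; have [a0|] := pselect (forall i, a i (t i) != 0).
    have [b Hb b1] := coordinates_normalize Ha a0.
    apply/(zero_locus1 Hb hm); rewrite eval_homogenization // eval_atM.
    apply/eqP; rewrite mulf_eq0 orbC; case: eqP => //= /eqP d0.
    by apply/eqP/p0; exists H.
  move=> /existsNP[i /negP]; rewrite negbK => /eqP ai0.
  by apply/(zero_locus1 Ha hm)/(eval_homogenization_eq0 _ ai0).
move=> a [H /sE EH [Ha a1 d0]]; move/(zero_locus1 Ha hm): EH.
rewrite eval_homogenization // eval_atM => /eqP.
by rewrite mulf_eq0 (negPf d0) orbF => /eqP.
Qed.

Lemma irreducible_normalized_prime t delta E p q : irreducible E ->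
  (forall a, normalized_coordinates t delta E a -> eval_at a (p * q) = 0) ->
  (forall a, normalized_coordinates t delta E a -> eval_at a p = 0) \/
  (forall a, normalized_coordinates t delta E a -> eval_at a q = 0).
Proof.
move=> [_ irrE] pq0; have hm r := @homogenization_multihomogeneous t (r * delta).
rewrite !sub_homogenization_locus; apply: irrE; try exact: zero_locus1_closed.
move=> H /(iffLR (sub_homogenization_locus _ _ _ _) pq0) EH.
have [a Ha] := coordinates_exist H; have [a0|] := pselect (forall i, a i (t i) != 0).
  have [b Hb b1] := coordinates_normalize Ha a0.
  move: EH; rewrite /setU/= !(zero_locus1 Hb) // !eval_homogenization // !eval_atM.
  by move=> /eqP; rewrite !mulf_eq0 -!orbA => /or3P[] /eqP->;
    rewrite ?(mul0r, mulr0); [left|right|left].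
move=> /existsNP[i /negP]; rewrite negbK => /eqP ai0; left.
by apply/(zero_locus1 Ha (hm _))/(eval_homogenization_eq0 _ ai0).
Qed.

(** If [p] vanished on the chart, [E] would be covered by the zero locus of [p] and the closed
    complement of the chart. The point [H] excludes the first, the given chart point the second. *)
Lemma irreducible_normalized_nonzero t delta E H p : irreducible E ->
  multihomogeneous p -> E H -> ~ zero_locus [set p] H ->
  (exists a, normalized_coordinates t delta E a) ->
  exists2 a, normalized_coordinates t delta E a & eval_at a p != 0.
Proof.
move=> [_ irrE] hp EH pH [a [K EK [Ka a1 da]]].
have hm := @homogenization_multihomogeneous t (1 * delta).
apply: contrapT => /forall2NP h.
have p0 b : normalized_coordinates t delta E b -> eval_at b p = 0.
  by move=> Nb; case: (h b) => // /negP; rewrite negbK => /eqP.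
have [||||] // := irrE (zero_locus [set p])
    (zero_locus [set homogenization t (1 * delta)]); try exact: zero_locus1_closed.
- move=> L EL; have [b Lb] := coordinates_exist L.
  rewrite /setU/= (zero_locus1 Lb hp) (zero_locus1 Lb hm).
  have [b0|] := pselect (forall i, b i (t i) != 0); last first.
    move=> /existsNP[i /negP]; rewrite negbK => /eqP bi0.
    by right; apply: (eval_homogenization_eq0 _ bi0).
  have [c Lc c1] := coordinates_normalize Lb b0.
  rewrite -(zero_locus1 Lb hp) -(zero_locus1 Lb hm).
  rewrite (zero_locus1 Lc hp) (zero_locus1 Lc hm) eval_homogenization // mul1r.
  have [->|d0] := eqVneq (eval_at c delta) 0; first by right.
  by left; apply: p0; exists L.
- by move=> sE; apply: pH; apply: sE.
- move=> /(_ K EK); rewrite (zero_locus1 Ka hm) eval_homogenization // mul1r.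
  by move=> /eqP; rewrite (negPf da).
Qed.

End Evaluation.

(** * Counting polynomial functions *)

Section PolynomialFunctions.
Context (F : fieldType) (T : finType).
Implicit Types (h : (T -> F) -> F) (B : nat).

(** The bound [B] is on the exponent of each variable separately, so that exactly [B.+1 ^ #|T|]
    monomials are available. *)
Definition polynomial_function B h :=
  exists2 s : seq (F * {ffun T -> nat}),
    (forall x, x \in s -> forall t, (x.2 t <= B)%N)
    & forall y, h y = \sum_(x <- s) x.1 * \prod_t y t ^+ x.2 t.

Lemma polynomial_function_le B B' h :
  (B <= B')%N -> polynomial_function B h -> polynomial_function B' h.
Proof.
by move=> le_B [s sB hE]; exists s => // x /sB h' t; exact: leq_trans le_B.
Qed.

Lemma polynomial_function_eq B h h' :
  h =1 h' -> polynomial_function B h -> polynomial_function B h'.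
Proof. by move=> e [s sB hE]; exists s => // y; rewrite -e. Qed.

Lemma polynomial_function_const B c : polynomial_function B (fun=> c).
Proof.
exists [:: (c, [ffun=> 0%N])] => [x|y]; first by rewrite inE => /eqP -> t; rewrite ffunE.
by rewrite big_seq1 /= big1 ?mulr1 // => t _; rewrite ffunE.
Qed.

Lemma polynomial_function_var t : polynomial_function 1 (fun y => y t).
Proof.
exists [:: (1, [ffun t' => nat_of_bool (t' == t)])] => [x|y].
  by rewrite inE => /eqP -> t'; rewrite ffunE leq_b1.
rewrite big_seq1 /= mul1r (bigD1 t) //= big1 ?mulr1 ?ffunE ?eqxx //.
by move=> t' /negPf nt; rewrite ffunE nt.
Qed.

Lemma polynomial_functionD B h h' : polynomial_function B h ->
  polynomial_function B h' -> polynomial_function B (fun y => h y + h' y).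
Proof.
move=> [s sB hE] [s' sB' hE']; exists (s ++ s') => [x|y].
  by rewrite mem_cat => /orP[/sB|/sB'].
by rewrite big_cat hE hE'.
Qed.

Lemma polynomial_functionM B B' h h' : polynomial_function B h ->
  polynomial_function B' h' -> polynomial_function (B + B') (fun y => h y * h' y).
Proof.
move=> [s sB hE] [s' sB' hE'].
exists [seq (x.1 * x'.1, [ffun t => x.2 t + x'.2 t]%N) |
    x : F * {ffun T -> nat} <- s, x' : F * {ffun T -> nat} <- s'].
  by move=> _ /allpairsP[x [/sB h1 /sB' h2 ->]] t; rewrite ffunE leq_add.
move=> y; rewrite big_allpairs_dep hE hE' mulr_suml; apply: eq_bigr => x _.
rewrite mulr_sumr; apply: eq_bigr => x' _ /=.
rewrite mulrACA; congr (_ * _); rewrite -big_split; apply: eq_bigr => t _ /=.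
by rewrite ffunE exprD.
Qed.

Lemma polynomial_functionX B h e : polynomial_function B h ->
  polynomial_function (e * B) (fun y => h y ^+ e).
Proof.
move=> ph; elim: e => [|e IH].
  by apply: polynomial_function_eq (polynomial_function_const _ 1) => y; rewrite expr0.
apply: polynomial_function_eq (polynomial_functionM ph IH) => y.
by rewrite exprS.
Qed.

Lemma polynomial_function_sum B (I : Type) (r : seq I) (P : pred I)
    (h : I -> (T -> F) -> F) :
  (forall i, polynomial_function B (h i)) ->
  polynomial_function B (fun y => \sum_(i <- r | P i) h i y).
Proof.
move=> ph; elim: r => [|i r IH].
  apply: polynomial_function_eq (polynomial_function_const _ 0) => y.
  by rewrite big_nil.
have [Pi|nPi] := boolP (P i).
  apply: polynomial_function_eq (polynomial_functionD (ph i) IH) => y.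
  by rewrite big_cons Pi.
by apply: polynomial_function_eq IH => y; rewrite big_cons (negPf nPi).
Qed.

Lemma polynomial_function_prod (I : Type) (r : seq I) (h : I -> (T -> F) -> F) :
  (forall i, exists B, polynomial_function B (h i)) ->
  exists B, polynomial_function B (fun y => \prod_(i <- r) h i y).
Proof.
move=> ph; elim: r => [|i r [B IH]].
  exists 0%N; apply: polynomial_function_eq (polynomial_function_const _ 1) => y.
  by rewrite big_nil.
have [B' hi] := ph i; exists (B' + B)%N.
by apply: polynomial_function_eq (polynomial_functionM hi IH) => y; rewrite big_cons.
Qed.

Lemma polynomial_function_eval (n k : nat) (psi : (T -> F) -> 'M[F]_(k, n.+1))
    (p : multipoly F n k) :
  (forall i j, exists B, polynomial_function B (fun y => psi y i j)) ->
  exists B, polynomial_function B (fun y => eval_at (psi y) p).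
Proof.
move=> hpsi.
have hX (m : multinom (k * n.+1)) : exists B,
    polynomial_function B (fun y => eval_at (psi y) (mpolyX F m)).
  have [B hB] : exists B, polynomial_function B
      (fun y => \prod_i \prod_j psi y i j ^+ m (mxvec_index i j)).
    apply: polynomial_function_prod => i; apply: polynomial_function_prod => j.
    have [B hB] := hpsi i j; exists (m (mxvec_index i j) * B)%N.
    exact: polynomial_functionX.
  exists B; apply: polynomial_function_eq hB => y.
  by rewrite eval_at_mpolyX.
rewrite [p]mpolyE; elim: (msupp p) => [|m r [B IH]].
  exists 0%N; apply: polynomial_function_eq (polynomial_function_const _ 0) => y.
  by rewrite big_nil /eval_at meval0.
have [B' hm] := hX m; exists (B' + B)%N.
have h1 := polynomial_functionM (polynomial_function_const 0 (mcoeff m p)) hm.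
have := polynomial_functionD (polynomial_function_le (leq_addr B _) h1)
  (polynomial_function_le (leq_addl _ _) IH).
by apply: polynomial_function_eq => y; rewrite big_cons eval_atD eval_atZ.
Qed.

(** There are more functions than monomials, so the matrix of coefficients has a nonzero left kernel
    vector. *)
Lemma polynomial_functions_dependent B (I : finType) (h : I -> (T -> F) -> F) :
  (forall i, polynomial_function B (h i)) -> (B.+1 ^ #|T| < #|I|)%N ->
  exists2 c : I -> F, exists i, c i != 0 & forall y, \sum_i c i * h i y = 0.
Proof.
move=> ph lt_I; pose E := {ffun T -> 'I_B.+1}.
have hE i : exists c : E -> F,
    forall y, h i y = \sum_e c e * \prod_t y t ^+ e t.
  have [s sB sE] := ph i.
  (* The list [s] may repeat an exponent, so the coefficients of equal exponents are added up;
     [inord] is faithful because exponents are at most [B]. *)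
  exists (fun e => \sum_(x <- s | [ffun t => inord (x.2 t)] == e) x.1) => y.
  under eq_bigr do rewrite mulr_suml.
  rewrite sE (exchange_big_dep predT) //= big_seq [RHS]big_seq.
  apply: eq_bigr => x xs; rewrite (big_pred1 [ffun t => inord (x.2 t)]) //.
  congr (_ * _); apply: eq_bigr => t _; rewrite ffunE inordK // ltnS.
  exact: sB.
pose c i := projT1 (cid (hE i)).
have cE i y : h i y = \sum_e c i e * \prod_t y t ^+ e t := projT2 (cid (hE i)) y.
pose M := \matrix_(i < #|I|, e < #|{: E}|) c (enum_val i) (enum_val e).
have: kermx M != 0.
  rewrite kermx_eq0 /row_free neq_ltn (leq_ltn_trans (rank_leq_col _)) //.
  by rewrite card_ffun card_ord.
case/rowV0Pn => u /sub_kermxP uM u0.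
exists (fun i => u 0 (enum_rank i)).
  apply/existsP; apply: contraNT u0 => /existsPn u0; apply/eqP/rowP => j.
  by have := u0 (enum_val j); rewrite negbK enum_valK mxE => /eqP.
move=> y; under eq_bigr do rewrite cE mulr_sumr.
rewrite exchange_big big1 //= => e _.
under eq_bigr do rewrite mulrA.
rewrite -mulr_suml.
have := congr1 (fun v : 'rV_(_) => v 0 (enum_rank e)) uM.
rewrite !mxE (reindex _ (onW_bij _ (enum_rank_bij _))) /= => h0.
rewrite -[X in X * _ = _]/(\sum_i u 0 (enum_rank i) * c i e).
rewrite (_ : \sum_i _ = 0) ?mul0r // -[RHS]h0; apply: eq_bigr => i _.
by rewrite mxE !enum_rankK.
Qed.

End PolynomialFunctions.

(** * Length of chains of prime loci, by counting independent products *)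

Section PrimeChain.
Context (F : fieldType) (n k : nat).
Implicit Types (E : set 'M[F]_(k, n.+1)) (p q : multipoly F n k).

Definition vanishes_on E p := forall a, E a -> eval_at a p = 0.

Definition prime_locus E :=
  forall p q, vanishes_on E (p * q) -> vanishes_on E p \/ vanishes_on E q.

Definition independent_on E (I : finType) (g : I -> multipoly F n k) :=
  forall c : I -> F, vanishes_on E (\sum_i c i *: g i) -> forall i, c i = 0.

Lemma vanishes_on_cancel_pow E p q e : prime_locus E -> ~ vanishes_on E p ->
  vanishes_on E (p ^+ e * q) -> vanishes_on E q.
Proof.
move=> prE np; elim: e => [|e IH]; first by rewrite expr0 mul1r.
by rewrite exprS -mulrA => /prE[].
Qed.

(** Take a relation on [E'] whose lowest power of [p] is [j']. Primeness allows division by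
    [p ^+ j']; restricting to [E], where [p] is zero, leaves only the terms of power [j'], and
    independence of [g] kills them. *)
Lemma independent_on_powers E E' (I : finType) (g : I -> multipoly F n k) p N :
  E `<=` E' -> prime_locus E' -> vanishes_on E p -> ~ vanishes_on E' p ->
  independent_on E g ->
  independent_on E' (fun x : I * 'I_N => g x.1 * p ^+ x.2).
Proof.
move=> sE prE' p0 np indg c c0.
(* Induction on the power of [p]: all coefficients at powers below [b] are zero. *)
suff h b (x : I * 'I_N) : (x.2 < b)%N -> c x = 0 by move=> x; exact: (h N).
elim: b x => // b IH [i j'] /= le_b.
apply: (indg (fun i => c (i, j'))) => a Ea.
(* [q] is what remains of the relation after division by [p ^+ j']. *)
pose q := \sum_(x : I * 'I_N | (j' <= x.2)%N) c x *: (g x.1 * p ^+ (x.2 - j')).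
have /(vanishes_on_cancel_pow prE' np) q0 : vanishes_on E' (p ^+ j' * q).
  move=> a' E'a'; rewrite -[RHS](c0 a' E'a'); congr eval_at.
  rewrite mulr_sumr [RHS](bigID (fun x : I * 'I_N => (j' <= x.2)%N)) /=.
  rewrite [X in _ + X]big1 ?addr0; last first.
    move=> x; rewrite -ltnNge => lt_x.
    by rewrite IH ?scale0r // (leq_trans lt_x).
  apply: eq_bigr => x le_x; rewrite -scalerAr; congr (_ *: _).
  by rewrite mulrCA -exprD subnKC.
rewrite -[RHS](q0 a (sE _ Ea)) !eval_at_sum.
rewrite [RHS](bigID (fun x : I * 'I_N => x.2 == j')) /= [X in _ = _ + X]big1.
  rewrite addr0; transitivity (\sum_i \sum_(j | j == j')
      eval_at a (c (i, j) *: (g i * p ^+ (j - j')))).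
    by apply: eq_bigr => i' _; rewrite big_pred1_eq subnn expr0 mulr1.
  rewrite pair_big /=; apply: eq_big => [[i' j2]|[]//] /=.
  by case: eqP => [->|_]; rewrite ?leqnn ?andbF.
move=> x /andP[le_x ne_x]; rewrite eval_atZ eval_atM eval_atX p0 //.
by rewrite expr0n subn_eq0 leqNgt ltn_neqAle eq_sym ne_x le_x /= !mulr0.
Qed.

(** The products of powers below [N] of the [f i] give [N ^ l] independent functions, of degree at
    most [l * (N * e)] in each of the [#|T|] parameters. For large [N] this exceeds the number of
    monomials unless [l <= #|T|]. *)
Lemma prime_chain_length (T : finType) (psi : (T -> F) -> 'M[F]_(k, n.+1))
    (l : nat) (E : nat -> set 'M[F]_(k, n.+1)) (f : nat -> multipoly F n k) :
  (forall i j, exists B, polynomial_function B (fun y => psi y i j)) ->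
  (forall a, E l a -> exists y, a = psi y) ->
  E 0%N !=set0 ->
  (forall i, (i < l)%N -> E i `<=` E i.+1) ->
  (forall i, (i <= l)%N -> prime_locus (E i)) ->
  (forall i, (i < l)%N -> vanishes_on (E i) (f i)) ->
  (forall i, (i < l)%N -> ~ vanishes_on (E i.+1) (f i)) ->
  (l <= #|T|)%N.
Proof.
move=> hpsi Epsi [a0 Ea0] sE prE f0 nf.
have [e fe] : exists e, forall i, (i < l)%N ->
    polynomial_function e (fun y => eval_at (psi y) (f i)).
  elim: l {Epsi sE prE f0 nf} => [|l [e IH]]; first by exists 0%N.
  have [e' he'] := polynomial_function_eval (f l) hpsi; exists (e + e')%N => i.
  rewrite ltnS leq_eqVlt => /orP[/eqP->|/IH].
    exact: polynomial_function_le (leq_addl _ _) he'.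
  exact: polynomial_function_le (leq_addr _ _).
have fam N j : (j <= l)%N -> exists (I : finType) (g : I -> multipoly F n k),
    [/\ #|I| = (N ^ j)%N, independent_on (E j) g
      & forall i, polynomial_function (j * (N * e)) (fun y => eval_at (psi y) (g i))].
  elim: j => [|j IH] lj.
    exists unit, (fun=> 1); split; first by rewrite card_unit.
      move=> c /(_ _ Ea0); rewrite eval_at_sum (big_pred1 tt) => [|[]//] h [].
      by move: h; rewrite eval_atZ eval_at1 mulr1.
    move=> i; have h1 := @polynomial_function_const F T (0 * (N * e)) 1.
    by refine (polynomial_function_eq _ h1) => y; rewrite eval_at1.
  have [I [g [cI ig pg]]] := IH (ltnW lj).
  exists (I * 'I_N)%type, (fun x : I * 'I_N => g x.1 * f j ^+ x.2); split.
  - by rewrite card_prod card_ord cI expnSr.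
  - exact: independent_on_powers (sE _ lj) (prE _ lj) (f0 _ lj) (nf _ lj) ig.
  - move=> [i x] /=; have := polynomial_functionX x (fe _ lj).
    have le_x : (x * e <= N * e)%N by rewrite leq_mul2r ltnW ?orbT.
    move=> /(polynomial_function_le le_x)/(polynomial_functionM (pg i)).
    rewrite -mulSnr; apply: polynomial_function_eq => y.
    by rewrite eval_atM eval_atX.
rewrite leqNgt; apply/negP => lt_l.
(* With these values [(l * (N * e)).+1 ^ #|T| <= N ^ #|T| * K ^ #|T| < N ^ #|T|.+1 <= N ^ l]. *)
pose K := (l * e).+1; pose N := (K ^ #|T|).+1.
have [I [g [cI ig pg]]] := fam N l (leqnn l).
have [|c [i ci] c0] := polynomial_functions_dependent pg.
  rewrite cI; apply: (@leq_trans (N ^ #|T|.+1)%N); last by rewrite leq_pexp2l.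
  apply: (@leq_ltn_trans ((N * K) ^ #|T|)%N).
    have leX t x y : (x <= y -> x ^ t <= y ^ t)%N.
      by case: t => // t ?; rewrite leq_exp2r.
    by apply: leX; rewrite /K mulnS mulnCA -addn1 addnC leq_add.
  by rewrite expnMn expnSr ltn_pmul2l ?expn_gt0.
move/eqP: ci; apply; apply: ig => a /Epsi[y ->].
rewrite eval_at_sum -[RHS](c0 y); apply: eq_bigr => i' _.
by rewrite eval_atZ.
Qed.

End PrimeChain.

(** * Intersections of hyperplanes and combinatorial equivalence *)

Section Intersections.
Context (F : fieldType) (n : nat).
Implicit Types (S A B : {fset hyperplane F n}) (K : hyperplane F n).

Lemma dim_hyperplane K : \dim (hyp_space K) = n.
Proof. exact/eqP/(valP K). Qed.

Lemma mem_bigcapv (I : eqType) (r : seq I) (P : pred I)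
    (U : I -> {vspace 'rV[F]_n.+1}) v :
  (v \in (\bigcap_(i <- r | P i) U i)%VS) = all (fun i => P i ==> (v \in U i)) r.
Proof.
elim: r => [|i r IH]; first by rewrite big_nil memvf.
by rewrite big_cons /=; case: (P i); rewrite //= memv_cap IH.
Qed.

Lemma mem_intersection S v :
  reflect (forall K, K \in S -> v \in hyp_space K) (v \in intersection S).
Proof. by rewrite /intersection mem_bigcapv; apply: (iffP allP). Qed.

Lemma intersection_sub S K : K \in S -> (intersection S <= hyp_space K)%VS.
Proof. by move=> KS; apply/subvP => v /mem_intersection; apply. Qed.

Lemma sub_intersection S (U : {vspace 'rV[F]_n.+1}) :
  (forall K, K \in S -> (U <= hyp_space K)%VS) -> (U <= intersection S)%VS.
Proof.
by move=> h; apply/subvP => v Uv; apply/mem_intersection => K /h/subvP; apply.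
Qed.

Lemma intersection_mono S A : (S `<=` A)%fset ->
  (intersection A <= intersection S)%VS.
Proof.
by move=> /fsubsetP SA; apply: sub_intersection => K /SA; exact: intersection_sub.
Qed.

Lemma intersectionU1 S K :
  intersection (K |` S)%fset = (hyp_space K :&: intersection S)%VS.
Proof.
apply/vspaceP => v; rewrite memv_cap; apply/mem_intersection/andP => [h|].
  split; first by apply: h; rewrite !inE eqxx.
  by apply/mem_intersection => L LS; apply: h; rewrite !inE LS orbT.
by move=> [vK /mem_intersection h] L; rewrite !inE => /orP[/eqP->|/h].
Qed.

Lemma dim_cap_hyperplane (U : {vspace 'rV[F]_n.+1}) K :
  \dim U = (\dim (hyp_space K :&: U) + ~~ (U <= hyp_space K)%VS)%N.
Proof.
have [UK|nUK] := boolP (U <= hyp_space K)%VS.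
  by rewrite addn0; congr (\dim _); apply/esym/capv_idPr.
have := dimv_sum_cap (hyp_space K) U.
have -> : \dim (hyp_space K + U) = n.+1.
  apply/eqP; rewrite eqn_leq; apply/andP; split.
    by rewrite (leq_trans (dimvS (subvf _))) // dimvf /dim /= mul1n.
  rewrite -[X in (X < _)%N](dim_hyperplane K).
  rewrite (ltn_leqif (dimv_leqif_sup (addvSl _ _))).
  by apply: contra nUK; apply: subv_trans; exact: addvSr.
by rewrite dim_hyperplane addSn -addnS addn1 => /addnI ->.
Qed.

Lemma intersectionU1_idP S K :
  (intersection S <= hyp_space K)%VS =
  (intersection (K |` S)%fset == intersection S).
Proof.
rewrite intersectionU1; apply/idP/eqP => [/capv_idPr //|<-]; exact: capvSl.
Qed.

Lemma lattice_intersection A S :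
  (S `<=` A)%fset -> intersection_lattice A (intersection S).
Proof. by move=> SA; exists S. Qed.

(** Add the hyperplanes one at a time: the dimension drops by one exactly when the intersection
    changes, and the injective [phi] detects whether it does. *)
Lemma combinatorially_equivalent_dim A B : combinatorially_equivalent A B ->
  exists2 s : hyperplane F n -> hyperplane F n, set_bij [set` A] [set` B] s &
  forall S, (S `<=` A)%fset ->
    \dim (intersection [fset s K | K in S]%fset) = \dim (intersection S).
Proof.
move=> [s [phi [bs [_ injphi _] _ phiE]]]; exists s => // S.
elim/fset1U_rect: S => [|K S KS IH]; first by rewrite imfset0.
rewrite fsubUset fsub1set => /andP[KA SA].
have KSA : (K |` S `<=` A)%fset by rewrite fsubUset fsub1set KA.
have eqU : (intersection (s K |` [fset s L | L in S])%fset ==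
    intersection [fset s L | L in S]%fset) =
    (intersection (K |` S)%fset == intersection S).
  have -> : (s K |` [fset s L | L in S])%fset = [fset s L | L in K |` S]%fset.
    by rewrite imfsetU1.
  rewrite -!phiE //; apply/eqP/eqP => [|->//]; apply: injphi;
    by apply/mem_set/lattice_intersection.
have /eqP := IH SA; rewrite imfsetU1 !intersectionU1.
rewrite (dim_cap_hyperplane (intersection S) K).
rewrite (dim_cap_hyperplane (intersection [fset s L | L in S]%fset) (s K)).
by rewrite !intersectionU1_idP eqU eqn_add2r => /eqP.
Qed.

Lemma combinatorially_equivalent_of_dim A B (s : hyperplane F n -> hyperplane F n) :
  set_bij [set` A] [set` B] s ->
  (forall S, (S `<=` A)%fset ->
    \dim (intersection [fset s K | K in S]%fset) = \dim (intersection S)) ->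
  combinatorially_equivalent A B.
Proof.
move=> bs dimE.
(* A lattice element is the intersection of all members of [A] containing it. This canonical
   subfamily lets [phi] be defined on subspaces without choosing a presentation. *)
pose flat U := [fset K in A | (U <= hyp_space K)%VS]%fset.
pose phi U := intersection [fset s K | K in flat U]%fset.
have flatA U : (flat U `<=` A)%fset by apply/fsubsetP => K; rewrite !inE => /andP[].
have sub_flat S : (S `<=` A)%fset -> (S `<=` flat (intersection S))%fset.
  move=> /fsubsetP SA; apply/fsubsetP => K KS.
  by rewrite !inE SA //= intersection_sub.
have interflat S : (S `<=` A)%fset ->
    intersection (flat (intersection S)) = intersection S.
  move=> SA; apply: subv_anti; rewrite intersection_mono ?sub_flat //=.
  by apply: sub_intersection => K; rewrite !inE => /andP[].
have imS S S' : (S `<=` S')%fset -> ([fset s K | K in S] `<=` [fset s K | K in S'])%fset.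
  move=> /fsubsetP SS'; apply/fsubsetP => _ /imfsetP[K /= KS ->].
  by apply: in_imfset => /=; exact: SS'.
have phiE S : (S `<=` A)%fset ->
    phi (intersection S) = intersection [fset s K | K in S]%fset.
  move=> SA; apply/eqP; rewrite eqEdim intersection_mono ?imS ?sub_flat //=.
  by rewrite !dimE // interflat.
have leE U W : intersection_lattice A U -> intersection_lattice A W ->
    lattice_le (phi U) (phi W) = lattice_le U W.
  move=> [S SA <-] [S' SA' <-]; rewrite !phiE // /lattice_le.
  (* Inclusion of intersections is read off from dimensions by passing to the union of the
     subfamilies. *)
  have cupE S1 S2 : (intersection S2 <= intersection S1)%VS =
      (\dim (intersection (S1 `|` S2)%fset) == \dim (intersection S2)).
    have sub2 := intersection_mono (fsubsetUr S1 S2).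
    rewrite (dimv_leqif_eq sub2); apply/idP/eqP => [le12|<-].
      apply: subv_anti; rewrite sub2 /=; apply: sub_intersection => K.
      rewrite inE => /orP[KS|]; last exact: intersection_sub.
      exact: subv_trans le12 (intersection_sub KS).
    exact/intersection_mono/fsubsetUl.
  by rewrite !cupE -imfsetU !dimE // fsubUset SA.
exists s, phi; split => //; split => //.
- move=> _ [S SA <-]; rewrite phiE //; apply: lattice_intersection.
  apply/fsubsetP => _ /imfsetP[K /= KS ->].
  have [sAB _ _] := bs; apply: (sAB K); exact: (fsubsetP SA).
- move=> U W /set_mem LU /set_mem LW eUW; apply: subv_anti.
  have := leE _ _ LU LW; have := leE _ _ LW LU; rewrite /lattice_le.
  by rewrite eUW subvv => <- <-.
- move=> _ [S' SB <-]; have [_ _ sur] := bs.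
  pose S := [fset K in A | s K \in S']%fset.
  have SA : (S `<=` A)%fset by apply/fsubsetP => K; rewrite !inE => /andP[].
  exists (intersection S); first exact: lattice_intersection.
  rewrite phiE //; congr intersection; apply/fsetP => L; apply/imfsetP/idP.
    by move=> [K /=]; rewrite !inE => /andP[_ h] ->.
  move=> LS'; have [K /= KA sK] := sur L (fsubsetP SB _ LS').
  by exists K => //=; rewrite !inE sK LS' KA.
Qed.

End Intersections.

(** * Tuples of hyperplanes with uniform matroid *)

Section GenericTuples.
Local Open Scope set_scope.
Context (F : fieldType) (n k m : nat).
Implicit Types (H : hyperplanes F n k) (I J : {set 'I_k}).

Definition tuple_intersection H I : {vspace 'rV[F]_n.+1} :=
  (\bigcap_(i in I) hyp_space (H i))%VS.

(* The matroid of the k linear forms is the uniform one of rank m+1. *)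
Definition generic_tuple H :=
  forall I, \dim (tuple_intersection H I) = (n.+1 - minn #|I| m.+1)%N.

Lemma mem_tuple_intersection H I v :
  reflect (forall i, i \in I -> v \in hyp_space (H i))
    (v \in tuple_intersection H I).
Proof.
rewrite /tuple_intersection mem_bigcapv; apply: (iffP allP) => h i.
  by move=> iI; have := h i; rewrite mem_index_enum iI; apply.
by move=> _; apply/implyP; exact: h.
Qed.

Lemma tuple_intersectionE H I :
  tuple_intersection H I = intersection [fset H i | i in I]%fset.
Proof.
apply/vspaceP => v; apply/mem_tuple_intersection/mem_intersection => h.
  by move=> _ /imfsetP[i /= iI ->]; exact: h.
by move=> i iI; apply: h; apply: in_imfset.
Qed.

Lemma tuple_intersectionU1 H I i :
  tuple_intersection H (i |: I) = (hyp_space (H i) :&: tuple_intersection H I)%VS.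
Proof.
apply/vspaceP => v; rewrite memv_cap; apply/mem_tuple_intersection/andP => [h|].
  split; first by apply: h; rewrite !inE eqxx.
  by apply/mem_tuple_intersection => j jI; apply: h; rewrite !inE jI orbT.
by move=> [vi /mem_tuple_intersection h] j; rewrite !inE => /orP[/eqP->|/h].
Qed.

Lemma tuple_intersection_mono H I J : I \subset J ->
  (tuple_intersection H J <= tuple_intersection H I)%VS.
Proof.
move=> /fintype.subsetP IJ; apply/subvP => v /mem_tuple_intersection h.
by apply/mem_tuple_intersection => i /IJ; exact: h.
Qed.

Lemma tuple_intersectionU_dim H I J :
  (\dim (tuple_intersection H I) <= \dim (tuple_intersection H (J :|: I)) + #|J|)%N.
Proof.
rewrite -[J in J :|: I]finset.set_enum cardE; elim: (enum J) => [|i r IH].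
  by rewrite finset.set_nil finset.set0U addn0.
rewrite finset.set_cons -finset.setUA tuple_intersectionU1 addnS -addSn.
apply: (leq_trans IH); rewrite leq_add2r (dim_cap_hyperplane _ (H i)).
by case: (~~ _); rewrite ?addn1 ?addn0.
Qed.

Lemma tuple_intersection0 H : tuple_intersection H finset.set0 = fullv.
Proof. by rewrite /tuple_intersection big_set0. Qed.

(** A larger family still meets in [Omega], since every member contains it. A smaller family [I] has
    codimension at most [#|I|], and not less, since the members added to reach [m.+1] lower the
    dimension by at most one each and must end in [Omega]. *)
Lemma generic_tuple_of_axis H (Omega : {vspace 'rV[F]_n.+1}) :
  (m < k)%N -> (m <= n)%N -> \dim Omega = (n - m)%N ->
  (forall I, #|I| = m.+1 -> tuple_intersection H I = Omega) ->
  generic_tuple H.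
Proof.
move=> lt_mk le_mn dimO capO I.
have extend I' : (#|I'| <= m.+1)%N -> exists2 J : {set 'I_k}, I' \subset J & #|J| = m.+1.
  move=> le_I; have : (m.+1 - #|I'| <= #|~: I'|)%N.
    by rewrite [X in (_ <= X)%N]cardsCs finset.setCK card_ord leq_sub2r.
  case/card_geqP => s [us ss sC].
  exists (I' :|: [set x in s]); first exact: finset.subsetUl.
  rewrite cardsU (_ : I' :&: _ = finset.set0) ?cards0 ?subn0.
    by rewrite cardsE (card_uniqP us) ss subnKC.
  apply/eqP; rewrite -finset.subset0; apply/fintype.subsetP => x; rewrite !inE.
  by move=> /andP[xI /sC]; rewrite inE xI.
case: (leqP #|I| m.+1) => [le_I|/ltnW ge_I]; last first.
  suff -> : tuple_intersection H I = Omega by rewrite dimO subSS.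
  have [s [us ss sI]] := card_geqP ge_I.
  apply: subv_anti; apply/andP; split.
    rewrite -(capO [set x in s]); last by rewrite cardsE (card_uniqP us).
    by apply: tuple_intersection_mono; apply/fintype.subsetP => x; rewrite inE => /sI.
  apply/subvP => v Ov; apply/mem_tuple_intersection => i _.
  have [|J iJ cJ] := extend [set i]; first by rewrite cards1.
  move: Ov; rewrite -(capO J cJ) => /mem_tuple_intersection; apply.
  by apply: (fintype.subsetP iJ); rewrite inE.
have [J IJ cJ] := extend I le_I.
have h1 := tuple_intersectionU_dim H finset.set0 I.
have h2 := tuple_intersectionU_dim H I (J :\: I).
rewrite finset.setU0 tuple_intersection0 dimvf /dim /= mul1n in h1.
rewrite finset.setDE finset.setUIl (finset.setUC (~: I)) finset.setUCr finset.setIT in h2.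
move: h2; rewrite (finset.setUidPl IJ) (capO J cJ) dimO -finset.setDE cardsD.
rewrite (finset.setIidPr IJ) cJ => h2.
apply/eqP; rewrite eqn_leq.
apply/andP; split; last by rewrite leq_subLR addnC.
by apply: (leq_trans h2); rewrite addnBA // addnS subnK.
Qed.

Lemma generic_tuple_perm H (s : 'S_k) :
  generic_tuple H -> generic_tuple [ffun i => H (s i)].
Proof.
move=> gH I; rewrite -(card_imset _ (@perm_inj _ s)) -gH.
congr (\dim _); apply/vspaceP => v.
apply/mem_tuple_intersection/mem_tuple_intersection => h i.
  by case/imsetP => j jI ->; have := h j jI; rewrite ffunE.
by move=> iI; rewrite ffunE; apply: h; exact: imset_f.
Qed.

Lemma generic_tuple_perm_iff H (s : 'S_k) :
  generic_tuple [ffun i => H (s i)] <-> generic_tuple H.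
Proof.
split=> [/(generic_tuple_perm (s^-1)%g)|]; last exact: generic_tuple_perm.
by congr generic_tuple; apply/ffunP => i; rewrite !ffunE permKV.
Qed.

Lemma generic_tuple_inj H : (0 < m)%N -> (0 < n)%N -> generic_tuple H -> injective H.
Proof.
move=> m0 n0 gH i j eH; apply: contrapT => /eqP ne_ij.
have := gH [set i; j]; rewrite cards2 ne_ij (minn_idPl _) // subn2.
have -> : tuple_intersection H [set i; j] = hyp_space (H i).
  apply/vspaceP => v; apply/mem_tuple_intersection/idP => [|vi l].
    by apply; rewrite !inE eqxx.
  by rewrite !inE => /orP[] /eqP -> //; rewrite -eH.
by rewrite dim_hyperplane; case: n n0 => // n' _ /= /eqP; rewrite eqn_leq ltnn.
Qed.

Lemma is_ordering_image H : injective H -> is_ordering [fset H i | i in 'I_k]%fset H.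
Proof.
move=> injH; split=> // K; split=> [/imfsetP[i _ ->]|[i <-]]; first by exists i.
by apply/imfsetP; exists i.
Qed.

(** The equivalence carries [H] to an ordering of [B], which differs from [H'] by a permutation, and
    genericity is invariant under permutations. *)
Lemma combinatorially_equivalent_generic A B H H' :
  is_ordering A H -> is_ordering B H' -> combinatorially_equivalent A B ->
  generic_tuple H -> generic_tuple H'.
Proof.
move=> [injH AH] [injH' BH'] /combinatorially_equivalent_dim[s bs dimE] gH.
have [sAB injs _] := bs.
have sB i : {j | H' j = s (H i)}.
  by apply/cid/BH'/sAB/AH; exists i.
have tinj : injective (fun i => projT1 (sB i)).
  move=> i j e; apply: injH; apply: injs; try (by apply/mem_set/AH; eexists).
  by rewrite -(projT2 (sB i)) -(projT2 (sB j)) e.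
apply/(generic_tuple_perm_iff _ (perm tinj)) => I.
rewrite -gH !tuple_intersectionE -(dimE [fset H i | i in I]%fset); last first.
  by apply/fsubsetP => _ /imfsetP[i /= _ ->]; apply/AH; exists i.
congr (\dim (intersection _)); rewrite -imfset_comp; apply: eq_in_imfset => //= i _.
by rewrite ffunE permE; exact: projT2 (sB i).
Qed.

(** The map [H i] to [H' i] preserves all dimensions of intersections, as both are given by the same
    function of the number of hyperplanes. *)
Lemma generic_combinatorially_equivalent A B H H' :
  is_ordering A H -> is_ordering B H' ->
  generic_tuple H -> generic_tuple H' -> combinatorially_equivalent A B.
Proof.
move=> [injH AH] [injH' BH'] gH gH'.
pose s K := if [pick i | H i == K] is Some i then H' i else K.
have sE i : s (H i) = H' i.
  by rewrite /s; case: pickP => [j /eqP/injH->//|/(_ i)]; rewrite eqxx.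
apply: (@combinatorially_equivalent_of_dim _ _ _ _ s).
  split.
  - by move=> K /AH[i <-]; rewrite /= sE; apply/BH'; exists i.
  - move=> K L /set_mem/AH[i <-] /set_mem/AH[j <-]; rewrite !sE => /injH' ->//.
  - move=> K /BH'[i <-]; exists (H i); last exact: sE.
    by apply/AH; exists i.
move=> S /fsubsetP SA; pose I := [set i | H i \in S].
have -> : S = [fset H i | i in I]%fset.
  apply/fsetP => K; apply/idP/imfsetP => [KS|[i /= + ->]]; last by rewrite inE.
  by have /AH[i iK] := SA _ KS; exists i; rewrite //= inE iK.
rewrite -imfset_comp -tuple_intersectionE gH -gH' tuple_intersectionE.
by congr (\dim (intersection _)); apply: eq_in_imfset => //= i _.
Qed.

End GenericTuples.

(** * The moduli space as a set of generic tuples *)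

Section ModuliSpace.
Context (F : fieldType) (n d : nat) (A : {fset hyperplane F n}).

Lemma ordering_exists : exists H : hyperplanes F n #|` A|, is_ordering A H.
Proof.
exists [ffun i => tnth (in_tuple (enum_fset A)) i]; split.
  move=> i j; rewrite !ffunE.
  exact: (elimT (tuple_uniqP (in_tuple (enum_fset A))) (fset_uniq A)).
move=> K; split=> [KA|[i <-]]; last by rewrite ffunE mem_tnth.
have /tnthP[i iE] : K \in in_tuple (enum_fset A) by [].
by exists i; rewrite ffunE.
Qed.

(** Here [m] is the projective dimension of the base [Pi], and the vertex [Omega] of the cone is the
    common intersection of any [m.+1] hyperplanes. *)
Lemma coned_generic_tuple : coned_generic d A -> exists m,
  [/\ n = (m + d.+1)%N, (0 < m)%N, (m < #|` A|)%N
    & forall H : hyperplanes F n #|` A|, is_ordering A H -> generic_tuple m H].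
Proof.
move=> [ltnA [Pi [Omega [B [dimPi dimO capPi [m [dimm UB ltmB gB]] AB]]]]].
have nE : n = (m + d.+1)%N by rewrite -dimPi dimm addnS.
have cardA : (#|` A| <= #|` B|)%N.
  have <- : #|` [fset hyp_space K | K in A]%fset| = #|` A|%fset.
    by rewrite card_imfset //; exact: val_inj.
  by rewrite AB; exact: leq_imfset_card.
(* For [m] zero the only possible member of [B] is the zero space, so [A] has at most one
   hyperplane, against [n < #|A|] with [n] positive. *)
have m0 : (0 < m)%N.
  rewrite lt0n; apply: contraTneq ltnA => m0; rewrite -leqNgt.
  have n1 : (1 <= n)%N by rewrite nE addnS.
  apply: (leq_trans cardA); apply: leq_trans n1.
  apply: (@leq_trans #|` [fset 0%VS : {vspace 'rV[F]_n.+1}]|%fset).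
    apply/fsubset_leq_card/fsubsetP => U /UB[_].
    by rewrite m0 => /eqP; rewrite dimv_eq0 inE.
  by rewrite cardfs1.
have ltmA : (m < #|` A|)%N by apply: leq_trans ltnA; rewrite nE leq_addr.
exists m; split=> // H [injH AH].
apply: (@generic_tuple_of_axis _ _ _ _ _ Omega) => //.
- by rewrite nE leq_addr.
- by rewrite dimO nE addKn.
move=> I cI.
have HE i : {U | U \in B & hyp_space (H i) = (Omega + U)%VS}.
  apply/cid2; have : hyp_space (H i) \in [fset hyp_space K | K in A]%fset.
    by apply: in_imfset => /=; apply/AH; exists i.
  by rewrite AB => /imfsetP[U /= UinB ->]; exists U.
have fullE : (Pi + Omega)%VS = fullv.
  apply/eqP; rewrite eqEdim subvf /= dimvf /dim /= mul1n.
  by rewrite dimv_disjoint_sum // dimO addnS dimPi.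
apply/vspaceP => v; apply/mem_tuple_intersection/idP => [vI|vO i _]; last first.
  by have [U _ ->] := HE i; apply: subvP (addvSl _ _) _ vO.
have /memv_addP[h hPi [w wO vE]] : v \in (Pi + Omega)%VS by rewrite fullE memvf.
(* Because [Pi] and [Omega] are independent, the [Pi]-component of a vector of [Omega + U] lies in
   [U]. *)
have hU i : i \in I -> h \in s2val (HE i).
  move=> iI; case: (HE i) => U UinB /= HiE.
  have : h \in hyp_space (H i).
    rewrite (_ : h = v - w); last by rewrite vE addrK.
    by apply: memvB; [exact: vI|rewrite HiE; apply: subvP (addvSl _ _) _ wO].
  rewrite HiE => /memv_addP[w' w'O [u uU hE]].
  have [/subvP UPi _] := UB _ UinB.
  have : w' \in (Pi :&: Omega)%VS.
    have w'E : w' = h - u by rewrite hE addrK.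
    by rewrite memv_cap w'O andbT w'E; apply: memvB => //; exact: UPi.
  by rewrite capPi memv0 => /eqP w'0; rewrite hE w'0 add0r.
have [h0|h0] := eqVneq h 0; first by rewrite vE h0 add0r.
(* A nonzero [h] would be a point in [m.+1] members of [B]; these are distinct because the
   hyperplanes [H i] are. *)
have := gB h h0 hPi; rewrite leqNgt => /negP; case.
rewrite -cI cardE -(size_map (fun i => s2val (HE i))).
apply: uniq_leq_size.
  rewrite map_inj_uniq ?enum_uniq // => i j eij; apply: injH; apply: val_inj.
  by rewrite /= (s2valP' (HE i)) (s2valP' (HE j)) eij.
move=> _ /mapP[i + ->]; rewrite mem_enum => iI.
by rewrite !inE hU // andbT; case: (HE i).
Qed.

Lemma moduli_space_generic (m : nat) (H0 H : hyperplanes F n #|` A|) :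
  (0 < m)%N -> (0 < n)%N -> is_ordering A H0 -> generic_tuple m H0 ->
  moduli_space A (orbit_of H) <-> generic_tuple m H.
Proof.
move=> m0 n0 AH0 gH0; split=> [[B [H' [cAB BH' /eqmodP/existsP[s /eqP H'E]]]]|gH].
  have := combinatorially_equivalent_generic AH0 BH' cAB gH0.
  by rewrite H'E => /generic_tuple_perm_iff.
have BH := is_ordering_image (generic_tuple_inj m0 n0 gH).
exists [fset H i | i in 'I_#|` A|]%fset, H; split=> //.
exact: generic_combinatorially_equivalent AH0 BH gH0 gH.
Qed.

End ModuliSpace.

(** * Irreducible chains in the quotient *)

Lemma irreducible_finite_cover (T : topologicalType) (I : finType) (E : set T)
    (C : I -> set T) :
  irreducible E -> (forall i, closed (C i)) ->
  (forall x, E x -> exists i, C i x) -> exists i, E `<=` C i.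
Proof.
move=> [[x0 Ex0] irrE] clC cov.
suff : forall r : seq I, closed [set x | exists2 i, i \in r & C i x] /\
    (E `<=` [set x | exists2 i, i \in r & C i x] -> exists i, E `<=` C i).
  move=> /(_ (enum I))[_]; apply=> x /cov[i ix]; exists i => //.
  by rewrite mem_enum.
elim=> [|i r [clr IH]].
  have e0 : [set x | exists2 i, i \in [::] & C i x] = set0.
    by apply/seteqP; split => // x [].
  by rewrite e0; split; [exact: closed0|move=> /(_ _ Ex0)].
have e1 : [set x | exists2 j, j \in i :: r & C j x] =
    C i `|` [set x | exists2 j, j \in r & C j x].
  apply/seteqP; split => [x [j]|x].
    by rewrite inE => /orP[/eqP->|jr] jx; [left|right; exists j].
  by move=> [ix|[j jr jx]]; [exists i|exists j] => //; rewrite inE ?eqxx ?jr ?orbT.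
rewrite {}e1; split; first exact: closedU.
by move=> cov'; have [h|] := irrE _ _ (clC i) clr cov'; [exists i|exact: IH].
Qed.

(** * The action of the symmetric group on tuples and polynomials *)

Section Permutations.
Context (F : fieldType) (n k : nat).
Implicit Types (H : hyperplanes F n k) (s t : 'S_k) (E : set (hyperplanes F n k)).

Definition permute s H : hyperplanes F n k := [ffun i => H (s i)].

Lemma permute1 H : permute 1%g H = H.
Proof. by apply/ffunP => i; rewrite ffunE perm1. Qed.

Lemma permuteM s t H : permute s (permute t H) = permute (s * t)%g H.
Proof. by apply/ffunP => i; rewrite !ffunE permM. Qed.

Lemma permuteK s : cancel (permute s) (permute s^-1%g).
Proof. by move=> H; rewrite permuteM mulVg permute1. Qed.

Lemma permuteVK s : cancel (permute s^-1%g) (permute s).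
Proof. by move=> H; rewrite permuteM mulgV permute1. Qed.

Lemma orbit_of_eq H H' : orbit_of H = orbit_of H' <-> exists s, H' = permute s H.
Proof.
split=> [/eqmodP/existsP[s /eqP ->]|[s ->]]; first by exists s.
by apply/eqmodP/existsP; exists s.
Qed.

Lemma orbit_of_permute s H : orbit_of (permute s H) = orbit_of H.
Proof. by apply/esym/orbit_of_eq; exists s. Qed.

Definition permuted_exponent s (m : multinom (k * n.+1)) : multinom (k * n.+1) :=
  Multinom [tuple mxvec (row_perm s^-1%g (vec_mx (\row_l' m l'))) 0 l
    | l < k * n.+1].

Definition permuted_poly s (p : multipoly F n k) : multipoly F n k :=
  \sum_(m <- msupp p) mcoeff m p *: mpolyX F (permuted_exponent s m).

Lemma permuted_exponentE s m i j :
  permuted_exponent s m (mxvec_index i j) = m (mxvec_index (s^-1%g i) j).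
Proof. by rewrite mnmE mxvecE !mxE. Qed.

Lemma permuted_poly_multihomogeneous s p :
  multihomogeneous p -> multihomogeneous (permuted_poly s p).
Proof.
move=> [e pe]; exists (fun i => e (s^-1%g i)).
move=> m /msupp_sum_le/flatten_mapP[m' /[!mem_filter]/= m'p].
move=> /msuppZ_le /[!msuppX] /[!inE]/eqP-> i.
by rewrite -(pe m') //; apply: eq_bigr => j _; rewrite permuted_exponentE.
Qed.

Lemma eval_permuted_poly s p a :
  eval_at a (permuted_poly s p) = eval_at (row_perm s a) p.
Proof.
rewrite /permuted_poly eval_at_sum [in RHS](mpolyE p) eval_at_sum.
apply: eq_bigr => m _; rewrite !eval_atZ !eval_at_mpolyX; congr (_ * _).
rewrite (reindex_inj (@perm_inj _ s)); apply: eq_bigr => i _.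
by apply: eq_bigr => j _; rewrite permuted_exponentE permK mxE.
Qed.

Lemma coordinates_permute s H a :
  coordinates H a -> coordinates (permute s H) (row_perm s a).
Proof.
move=> Ha i; have [a0 aE] := Ha (s i); rewrite ffunE.
by have -> : row i (row_perm s a) = row (s i) a by apply/rowP => j; rewrite !mxE.
Qed.

Lemma closed_permute s E : closed E -> closed (permute s @^-1` E).
Proof.
move=> /closed_zero_locus[P hP ->].
rewrite (_ : _ @^-1` _ = zero_locus [set permuted_poly s p | p in P]).
  by apply: zero_locus_closed => _ [p /hP hp <-]; exact: permuted_poly_multihomogeneous.
apply/seteqP; split => H HP.
  move=> _ a [p Pp <-] Ha; rewrite eval_permuted_poly.
  by apply: HP => //; exact: coordinates_permute.
move=> p b Pp Hb; have [a Ha] := coordinates_exist H.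
apply: (eval_at_coordinates (coordinates_permute s Ha) Hb (hP _ Pp)).
by rewrite -eval_permuted_poly; apply: HP Ha; exists p.
Qed.

Lemma irreducible_permute s E : irreducible E -> irreducible (permute s @^-1` E).
Proof.
move=> [[H EH] irrE]; split.
  by exists (permute s^-1%g H); rewrite /preimage/= permuteVK.
move=> Z1 Z2 cZ1 cZ2 cov.
have shift Z : permute s @^-1` E `<=` Z <-> E `<=` permute s^-1%g @^-1` Z.
  by split=> h K EK; [apply: h; rewrite /preimage/= permuteVK|
    rewrite -[K](permuteK s); exact: h].
rewrite !shift; apply: irrE; try exact: closed_permute.
by apply/(shift (Z1 `|` Z2)).
Qed.

End Permutations.

(** * Lifting chains from the quotient and projecting them to it *)

Section Quotient.
Context (F : fieldType) (n k : nat) (M : set (unordered_hyperplanes F n k)).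
Implicit Types (H : hyperplanes F n k) (s : 'S_k) (E D : set (hyperplanes F n k)).
Implicit Types (Z : set (set_type M)).

Definition orderings Z : set (hyperplanes F n k) :=
  [set H | exists2 t : set_type M, Z t & set_val t = orbit_of H].

Definition orbits D : set (set_type M) :=
  [set t | exists2 H, D H & set_val t = orbit_of H].

Lemma orderings_closed Z : closed Z -> exists2 D, closed D
  & forall H, orderings Z H <-> M (orbit_of H) /\ D H.
Proof.
rewrite -openC => -[U oU ZU]; exists (@orbit_of F n k @^-1` (~` U)).
  by rewrite preimage_setC -openC setCK.
have ZE t : Z t <-> ~ U (set_val t).
  split=> [Zt Ut|nU]; first by have : (~` Z) t by rewrite -ZU.
  by apply: contrapT => nZ; apply: nU; move: (nZ : (~` Z) t); rewrite -ZU.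
move=> H; split=> [[t Zt tH]|[MH nU]].
  by rewrite /preimage/= -tH; split; [exact: set_valP|exact/ZE].
by exists (SigSub (mem_set MH)) => //; apply/ZE.
Qed.

(** The preimage of the image of [D] is a finite union of permuted copies of [D]. *)
Lemma orbits_closed D : closed D -> closed (orbits D).
Proof.
move=> cD; pose S := [set q | exists2 H, D H & q = orbit_of H].
suff cS : closed (@orbit_of F n k @^-1` S).
  by rewrite -openC; exists (~` S) => //; move: cS; rewrite -openC.
rewrite (_ : _ @^-1` _ = \bigcup_(s in [set: 'S_k]) permute s @^-1` D).
  by apply: closed_bigcup => [|s _]; [exact: finite_finset|exact: closed_permute].
apply/seteqP; split => [H [H' DH' /orbit_of_eq[s H'E]]|H [s _ DH]].
  by exists s => //; rewrite /preimage/= -H'E.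
by exists (permute s H) => //; rewrite orbit_of_permute.
Qed.

(** The first clause is closedness relative to the preimage of [M], expressed without giving that
    preimage a topology of its own. *)
Definition is_lift Z E :=
  [/\ exists2 D, closed D & forall H, E H <-> M (orbit_of H) /\ D H,
      irreducible E, E `<=` orderings Z
    & forall H, orderings Z H -> exists s, E (permute s H)].

Lemma orderings_permute Z s H : orderings Z (permute s H) <-> orderings Z H.
Proof. by rewrite /orderings/= orbit_of_permute. Qed.

(* A minimal closed set meeting every orbit of the preimage of Z is
   irreducible; minimal ones exist since the orbits are finite. *)
Lemma lift_exists Z : closed Z -> irreducible Z -> exists E, is_lift Z E.
Proof.
move=> cZ [[t0 Zt0] irrZ]; have [D cD DZ] := orderings_closed cZ.
(* Minimal closed sets are sought through their complements: Zorn's lemma provides a maximal open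
   set containing no whole orbit over [Z]. *)
pose Fam : set (set (hyperplanes F n k)) := [set O | open O /\
  forall H, orderings Z H -> exists s, ~ O (permute s H)].
have [] := @Zorn_bigcup _ Fam.
  move=> C CFam totC; split.
    by apply: bigcup_open => O /CFam[].
  move=> H ZH; apply: contrapT => /forallNP nall.
  have all_s s : exists2 O, C O & O (permute s H).
    have /contrapT[O CO OH] := nall s; by exists O.
  (* There are finitely many permutations and [C] is totally ordered, so an orbit inside the union
     would already lie in one member. *)
  suff [O CO OH] : exists2 O, C O & forall s, s \in enum 'S_k -> O (permute s H).
    have [_ /(_ H ZH)[s]] := CFam _ CO; apply; apply: OH; exact: mem_enum.
  elim: (enum 'S_k) => [|s r [O CO OH]]; first by have [O CO _] := all_s 1%g; exists O.
  have [O' CO' O'H] := all_s s.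
  have [OO'|O'O] := totC _ _ CO CO'.
    by exists O' => // s'; rewrite inE => /orP[/eqP->//|/OH/OO'].
  by exists O => // s'; rewrite inE => /orP[/eqP->|/OH//]; exact: O'O.
move=> O [[oO OZ] maxO].
exists [set H | orderings Z H /\ ~ O H]; split.
- exists (D `&` ~` O); first by apply: closedI => //; rewrite closedC.
  by move=> H; rewrite /setI/= DZ; tauto.
- split.
    have [H tH] : exists H, set_val t0 = orbit_of H.
      by exists (repr (set_val t0)); rewrite /orbit_of reprK.
    have ZH : orderings Z H by exists t0.
    by have [s nO] := OZ H ZH; exists (permute s H); split=> //; apply/orderings_permute.
  move=> Z1 Z2 cZ1 cZ2 cov.
  have cW Zi : closed Zi -> closed (orbits (~` O `&` Zi)).
    by move=> cZi; apply: orbits_closed; apply: closedI => //; rewrite closedC.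
  have covW : Z `<=` orbits (~` O `&` Z1) `|` orbits (~` O `&` Z2).
    move=> t Zt; have [H tH] : exists H, set_val t = orbit_of H.
      by exists (repr (set_val t)); rewrite /orbit_of reprK.
    have ZH : orderings Z H by exists t.
    have [s nO] := OZ H ZH.
    have [|z1|z2] := cov (permute s H); first by split=> //; apply/orderings_permute.
      by left; exists (permute s H); rewrite ?orbit_of_permute.
    by right; exists (permute s H); rewrite ?orbit_of_permute.
  have minO Zi : closed Zi -> Z `<=` orbits (~` O `&` Zi) -> ~` O `<=` Zi.
    move=> cZi ZW H nO; apply: contrapT => nZi; apply: (maxO (O `|` ~` Zi)).
      split=> [K OK|/(_ H)]; first by left.
      by move=> /(_ (or_intror nZi)).
    split; first by apply: openU => //; rewrite openC.
    move=> K [t Zt tK]; have [H' [nO' ZiH'] tH'] := ZW t Zt.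
    have /orbit_of_eq[s H'E] : orbit_of K = orbit_of H' by rewrite -tK -tH'.
    by exists s; rewrite -H'E => -[].
  by have [/minO h|/minO h] := irrZ _ _ (cW _ cZ1) (cW _ cZ2) covW; [left|right];
    move=> H [_ nO]; apply: h.
- by move=> H [].
- by move=> H ZH; have [s nO] := OZ H ZH; exists s; split=> //; apply/orderings_permute.
Qed.

Lemma is_lift_permute Z E s : is_lift Z E -> is_lift Z (permute s @^-1` E).
Proof.
move=> [[D cD DE] irrE sE tE]; split.
- exists (permute s @^-1` D); first exact: closed_permute.
  by move=> H; rewrite /preimage/= DE orbit_of_permute.
- exact: irreducible_permute.
- by move=> H /sE /orderings_permute.
- move=> H /tE[t Et]; exists (s^-1 * t)%g.
  by rewrite /preimage/= permuteM mulKVg.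
Qed.

(** The irreducible [E] is covered by the finitely many permuted copies of [E'], hence lies in one
    of them. *)
Lemma lift_subset Z Z' E E' : Z `<=` Z' -> is_lift Z E -> is_lift Z' E' ->
  exists s, E `<=` permute s @^-1` E'.
Proof.
move=> ZZ' [[D cD DE] irrE sE tE] [[D' cD' DE'] _ _ tE'].
have [|H EH|s sED'] := @irreducible_finite_cover _ 'S_k E
    (fun s => permute s @^-1` D') irrE.
- by move=> s; exact: closed_permute.
- have [t Zt tH] := sE H EH.
  have [|s /DE'[_ D'H]] := tE' H; first by exists t => //; exact: ZZ'.
  by exists s.
- exists s => H EH; apply/DE'; split; last exact: sED'.
  by rewrite orbit_of_permute; have /DE[] := EH.
Qed.

(** Built from the bottom up: each new lift is permuted so as to contain the previous one. *)
Lemma lift_chain (l : nat) (Z : nat -> set (set_type M)) :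
  (forall i, (i <= l)%N -> closed (Z i) /\ irreducible (Z i)) ->
  (forall i, (i < l)%N -> Z i `<=` Z i.+1) ->
  exists E : nat -> set (hyperplanes F n k),
    (forall i, (i <= l)%N -> is_lift (Z i) (E i)) /\
    (forall i, (i < l)%N -> E i `<=` E i.+1).
Proof.
elim: l => [|l IH] hZ sZ.
  have [E hE] := lift_exists (hZ 0%N isT).1 (hZ 0%N isT).2.
  by exists (fun=> E); split=> // -[].
have [|i il|E [hE sE]] := IH.
- by move=> i il; apply: hZ; exact: leqW.
- by apply: sZ; exact: leqW.
have [E' hE'] := lift_exists (hZ l.+1 (leqnn _)).1 (hZ l.+1 (leqnn _)).2.
have [s sEE'] := lift_subset (sZ l (leqnn _)) (hE l (leqnn _)) hE'.
exists (fun i => if (i <= l)%N then E i else permute s @^-1` E'); split=> i.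
  move=> il1; have [il|li] := leqP i l; first exact: hE.
  have -> : i = l.+1 by apply/eqP; rewrite eqn_leq il1.
  exact: is_lift_permute.
rewrite ltnS => il; rewrite il; have [il1|li] := ltnP i l; first exact: sE.
by have -> : i = l by apply/eqP; rewrite eqn_leq il.
Qed.

(** The common form for both bounds. The members need not be closed; strictness is witnessed by a
    polynomial and a point, which is what the counting argument consumes and what the flag of
    parameters produces. *)
Definition separated_chain (l : nat) (E : nat -> set (hyperplanes F n k)) :=
  [/\ forall i, (i <= l)%N -> irreducible (E i) /\ (forall H, E i H -> M (orbit_of H)),
      forall i, (i < l)%N -> E i `<=` E i.+1
    & forall i, (i < l)%N -> exists p H, [/\ multihomogeneous p,
        E i `<=` zero_locus [set p], E i.+1 H & ~ zero_locus [set p] H]].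

Lemma irreducible_chain_lift (l : nat) (Z : 'I_l.+1 -> set (set_type M)) :
  irreducible_chain Z -> exists G, separated_chain l G.
Proof.
move=> [hZ ltZ]; pose Z' i := Z (inord i).
have ltZ' i : (i < l)%N -> Z' i `<` Z' i.+1.
  by move=> il; apply: ltZ; rewrite !inordK // ltnS // ltnW.
have [i _|i /ltZ'/properW//|E [hE sE]] := @lift_chain l Z'; first exact: hZ.
exists E; split=> // i il.
  by have [[D _ DE] irrE _ _] := hE i il; split=> // H /DE[].
have [[D cD DE] _ _ tE] := hE i (ltnW il).
have [_ _ sE' _] := hE i.+1 il.
have [_ nZ] := ltZ' i il.
have [H EH nE] : exists2 H, E i.+1 H & ~ E i H.
  apply: contrapT => /forall2NP nex; apply: nZ => t Zt.
  have [H tH] : exists H, set_val t = orbit_of H.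
    by exists (repr (set_val t)); rewrite /orbit_of reprK.
  have [_ _ _ tE'] := hE i.+1 il.
  have [|s EsH] := tE' H; first by exists t.
  have [//|/contrapT EiH] := nex (permute s H).
  have [_ _ sEi _] := hE i (ltnW il).
  have [t' Zt' t'H] := sEi _ EiH.
  by rewrite (_ : t = t') //; apply: val_inj; rewrite -!set_valE tH t'H orbit_of_permute.
have nD : ~ D H.
  move=> DH; apply: nE; apply/DE; split=> //.
  by have [[? _ DE'] _ _ _] := hE i.+1 il; have /DE'[] := EH.
have [p [hp Dp pH]] := closed_separate cD nD.
by exists p, H; split=> // K /DE[_ /Dp].
Qed.

(** The delicate point is strictness in the quotient. If two successive images agreed,
    irreducibility would put [G i.+1] inside one permuted copy of the closure of [G i]; as
    permutations have finite order, it would lie in that closure itself, against the separating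
    polynomial. *)
Lemma separated_chain_orbits (l : nat) (G : nat -> set (hyperplanes F n k)) :
  separated_chain l G -> exists Z : 'I_l.+1 -> set (set_type M), irreducible_chain Z.
Proof.
move=> [hG sG sepG]; exists (fun i => orbits (closure (G i))).
have mono i j : (i <= j <= l)%N -> G i `<=` G j.
  move=> /andP[]; elim: j => [|j IH]; first by rewrite leqn0 => /eqP-> _ x.
  rewrite leq_eqVlt => /orP[/eqP-> _ x //|]; rewrite ltnS => ij jl.
  by apply: subset_trans (sG _ jl); apply: IH => //; exact: ltnW.
have monoZ i j : (i <= j <= l)%N -> orbits (closure (G i)) `<=` orbits (closure (G j)).
  by move=> /mono/closure_subset sGij t [H GH tH]; exists H => //; exact: sGij.
split=> [i|i j ij].
  have [[[H0 GH0] irrG] MG] := hG i (leq_ord i).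
  split; first by apply: orbits_closed; exact: closed_closure.
  split.
    exists (SigSub (mem_set (MG _ GH0))); exists H0 => //; exact: subset_closure.
  move=> W1 W2 cW1 cW2 cov.
  have [D1 cD1 D1W] := orderings_closed cW1; have [D2 cD2 D2W] := orderings_closed cW2.
  have covG : G i `<=` D1 `|` D2.
    move=> H GH; have MH := MG _ GH.
    have [|w1|w2] := cov (SigSub (mem_set MH)).
    - by exists H => //; exact: subset_closure.
    - by left; have /D1W[] : orderings W1 H by exists (SigSub (mem_set MH)).
    - by right; have /D2W[] : orderings W2 H by exists (SigSub (mem_set MH)).
  have conclude W D : closed D ->
      (forall H, orderings W H <-> M (orbit_of H) /\ D H) ->
      G i `<=` D -> orbits (closure (G i)) `<=` W.
    move=> cD DW GD t [H GH tH].
    have DH : D H by rewrite (closure_id D).1 //; exact: closure_subset GH.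
    have [|t' Wt' t'H] := (DW H).2; first by split=> //; rewrite -tH; exact: set_valP.
    by rewrite (_ : t = t') //; apply: val_inj; rewrite -!set_valE tH t'H.
  by have [h|h] := irrG _ _ cD1 cD2 covG; [left|right]; apply: conclude h.
have jl : (j <= l)%N := leq_ord j.
split; first by apply: monoZ; rewrite ltnW.
move=> ZjZi; have il : (i < l)%N := leq_trans ij jl.
have sub : orbits (closure (G i.+1)) `<=` orbits (closure (G i)).
  by apply: subset_trans ZjZi; apply: monoZ; rewrite ij.
have [p [H [hp Gp GH npH]]] := sepG i il.
have [irrG1 MG1] := hG i.+1 il.
have [s sGs] : exists s, G i.+1 `<=` permute s @^-1` closure (G i).
  apply: irreducible_finite_cover irrG1 _ _ => [s|K GK].
    by apply: closed_permute; exact: closed_closure.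
  have [|K' K'C /orbit_of_eq[s K'E]] := sub (SigSub (mem_set (MG1 _ GK))).
    by exists K => //; exact: subset_closure.
  by exists s; rewrite /preimage/= -K'E.
have sC : closure (G i.+1) `<=` permute s @^-1` closure (G i).
  rewrite [X in _ `<=` X](closure_id _).1; first exact: closure_subset.
  by apply: closed_permute; exact: closed_closure.
(* Since [G i] is contained in [G i.+1], the inclusion [sC] can be iterated; the order of [s] then
   brings the point back to itself. *)
have pow r K : closure (G i) K -> closure (G i) (permute (s ^+ r)%g K).
  elim: r K => [|r IH] K CK; first by rewrite expg0 permute1.
  rewrite expgS -permuteM; apply: sC; apply: (closure_subset (sG i il)); exact: IH.
apply: npH; have : closure (G i) H.
  have : closure (G i) (permute s H) by apply: sC; exact: subset_closure.
  move=> /(pow #[s]%g.-1); rewrite permuteM -expgSr prednK ?order_gt0 //.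
  by rewrite expg_order permute1.
move=> /(closure_subset Gp); rewrite -(closure_id _).1 //.
exact: zero_locus1_closed.
Qed.

End Quotient.

(** * Charts and the upper bound *)

Section MatrixRank.
Context (F : fieldType).

Lemma dim_row_space (N p : nat) (U : {vspace 'rV[F]_N}) (M : 'M[F]_(p, N)) :
  (forall x, (x \in U) = (x <= M)%MS) -> \dim U = \rank M.
Proof.
move=> UE; pose X := \matrix_(i < \dim U) (vbasis U)`_i.
have rowX i : row i X = (vbasis U)`_i by rewrite rowK.
have mulX (u : 'rV_(\dim U)) : u *m X = \sum_i u 0 i *: (vbasis U)`_i.
  by rewrite mulmx_sum_row; apply: eq_bigr => i _; rewrite rowX.
have -> : \dim U = \rank X.
  apply/esym/eqP/row_freeP; exists (pinvmx X); apply/eqP; rewrite -subr_eq0.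
  have free_inj (u : 'rV_(\dim U)) : u *m X = 0 -> u = 0.
    rewrite mulX => u0; apply/rowP => i; rewrite mxE.
    have /freeP fr := basis_free (vbasisP U).
    exact: (fr (fun i => u 0 i) u0 i).
  apply/eqP/row_matrixP => i; rewrite row0; apply: free_inj.
  by rewrite -row_mul mulmxBl mul1mx mulmxKpV ?subrr ?row0.
apply: eqmx_rank; apply/andP; split.
  by apply/row_subP => i; rewrite rowX -UE vbasis_mem // mem_nth // size_tuple.
apply/row_subP => i; have : row i M \in U by rewrite UE row_sub.
move=> /coord_vbasis ->; apply/submxP.
exists (\row_j coord (vbasis U) j (row i M)); rewrite mulX.
by apply: eq_bigr => j _; rewrite mxE.
Qed.

Lemma exists_invertible_minor (p q r : nat) (A : 'M[F]_(p, q)) : \rank A = r ->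
  exists (f : 'I_r -> 'I_p) (g : 'I_r -> 'I_q),
    injective g /\ mxsub f g A \in unitmx.
Proof.
move=> <-; pose A1 := rowsub (maxrankfun A) A.
have fA : row_full A1^T by rewrite /row_full mxrank_tr; exact: maxrowsub_free.
exists (maxrankfun A), (fullrankfun fA); split; first exact: fullrankfun_inj.
have := fullrowsub_unit fA; rewrite -unitmx_tr.
by congr (_ \in unitmx); apply/matrixP => i j; rewrite !mxE.
Qed.

(** The invertible minor makes the rows chosen by [f] span all rows of [A]; the coefficients of each
    row in them are recovered from the columns chosen by [g]. *)
Lemma minor_factorization (p q r : nat) (f : 'I_r -> 'I_p) (g : 'I_r -> 'I_q)
    (A : 'M[F]_(p, q)) :
  \rank A = r -> mxsub f g A \in unitmx ->
  A = colsub g A *m (invmx (mxsub f g A) *m rowsub f A).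
Proof.
move=> rA uG; pose A1 := rowsub f A.
have A1A : (A1 <= A)%MS.
  by apply/row_subP => i; rewrite row_rowsub row_sub.
have GE : mxsub f g A = colsub g A1 by apply/matrixP => i j; rewrite !mxE.
have le_r : (r <= \rank A1)%N.
  rewrite -[X in (X <= _)%N](mxrank_unit uG) GE -[A1]mulmx1 -mulmx_colsub.
  by rewrite mulmx1; exact: mxrankM_maxl.
have AA1 : (A <= A1)%MS.
  by rewrite -(geq_leqif (mxrank_leqif_sup A1A)) rA.
have [D AE] := submxP AA1.
have -> : colsub g A = D *m mxsub f g A by rewrite GE {1}AE mulmx_colsub.
by rewrite mulmxA mulmxK.
Qed.

End MatrixRank.

Section Coordinates.
Context (F : fieldType) (n k : nat).
Implicit Types (H : hyperplanes F n k) (a : 'M[F]_(k, n.+1)) (I : {set 'I_k}).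

Lemma mem_tuple_intersection_coordinates H a I (x : 'rV[F]_n.+1) :
  coordinates H a ->
  reflect (forall i, i \in I -> x *m (row i a)^T = 0) (x \in tuple_intersection H I).
Proof.
move=> Ha; apply: (iffP (mem_tuple_intersection _ _ _)) => h i /h.
  by rewrite (Ha i).2 => /eqP.
by move=> /eqP; rewrite (Ha i).2.
Qed.

Lemma mul_row_trmx_eq0 (p q : nat) (M : 'M[F]_(p, q)) (x : 'rV[F]_q) :
  x *m M^T = 0 <-> forall i, x *m (row i M)^T = 0.
Proof.
split=> [x0 i|x0].
  by rewrite tr_row colE mulmxA x0 mul0mx.
apply/rowP => i; have := congr1 (fun v : 'M_1 => v 0 0) (x0 i).
rewrite !mxE => {2}<-; apply: eq_bigr => j _; by rewrite !mxE.
Qed.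

(** The kernel of [a^T] is the intersection of all [k] hyperplanes, of dimension [n - m]. *)
Lemma generic_tuple_rank m H a : (m < k)%N -> (m <= n)%N -> generic_tuple m H ->
  coordinates H a -> \rank a = m.+1.
Proof.
move=> lt_mk le_mn gH Ha.
have dE : \dim (tuple_intersection H finset.setT) = \rank (kermx a^T).
  apply: dim_row_space => x; apply/idP/idP.
    move=> /(mem_tuple_intersection_coordinates _ _ Ha) h.
    by apply/sub_kermxP/mul_row_trmx_eq0 => i; apply: h; rewrite inE.
  move=> /sub_kermxP/mul_row_trmx_eq0 h.
  by apply/(mem_tuple_intersection_coordinates _ _ Ha) => i _; exact: h.
have := gH finset.setT; rewrite dE cardsT card_ord (minn_idPr lt_mk).
rewrite mxrank_ker mxrank_tr => rE.
by rewrite -(subKn (rank_leq_col a)) rE subKn.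
Qed.

Lemma eval_at_det r (f : 'I_r -> 'I_k) (g : 'I_r -> 'I_n.+1) a :
  eval_at a (\det (\matrix_(i, j) mpolyX F (mnm1 (mxvec_index (f i) (g j))))) =
  \det (mxsub f g a).
Proof.
rewrite /eval_at -det_map_mx; congr (\det _); apply/matrixP => i j.
by rewrite !mxE /= mevalXU mxvecE.
Qed.

End Coordinates.

(** * Parametrization of matrices of fixed rank *)

Section Chart.
Context (F : fieldType) (n k m : nat).
Context (g : 'I_m.+1 -> 'I_n.+1) (jj : 'I_k -> 'I_m.+1).

(* Matrices C * B, where B has the identity matrix in the columns g and the
   entry of row i of C in column jj i is 1; the other entries are free. *)
Definition chart_parameters : finType :=
  ({x : 'I_k * 'I_m.+1 | x.2 != jj x.1} +
   {x : 'I_m.+1 * 'I_n.+1 | x.2 \notin codom g})%type.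

Definition chart_left (y : chart_parameters -> F) : 'M[F]_(k, m.+1) :=
  \matrix_(i, j) if insub (i, j) is Some u then y (inl u) else 1.

Definition chart_right (y : chart_parameters -> F) : 'M[F]_(m.+1, n.+1) :=
  \matrix_(j, u) if insub (j, u) is Some w then y (inr w) else (u == g j)%:R.

Definition chart y := chart_left y *m chart_right y.

Lemma chart_polynomial i j :
  exists B, polynomial_function B (fun y => chart y i j).
Proof.
exists (1 + 1)%N; pose h l y := chart_left y i l * chart_right y l j.
apply: (@polynomial_function_eq _ _ _ (fun y => \sum_l h l y)).
  by move=> y; rewrite mxE.
apply: polynomial_function_sum => l; apply: polynomial_functionM.
  apply: (@polynomial_function_eq _ _ _
    (fun y => if insub (i, l) is Some u then y (inl u) else 1)).
    by move=> y; rewrite mxE.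
  case: insub => [u|]; first exact: polynomial_function_var.
  exact: polynomial_function_const.
apply: (@polynomial_function_eq _ _ _
  (fun y => if insub (l, j) is Some w then y (inr w) else (j == g l)%:R)).
  by move=> y; rewrite mxE.
case: insub => [u|]; first exact: polynomial_function_var.
exact: polynomial_function_const.
Qed.

Lemma chart_surjective (f : 'I_m.+1 -> 'I_k) (a : 'M[F]_(k, n.+1)) :
  injective g -> \rank a = m.+1 -> mxsub f g a \in unitmx ->
  (forall i, a i (g (jj i)) = 1) -> exists y, a = chart y.
Proof.
move=> injg ra uG a1; rewrite (minor_factorization ra uG).
set C := colsub g a; set B := _ *m rowsub f a.
exists (fun t => match t with
  | inl u => C (val u).1 (val u).2 | inr w => B (val w).1 (val w).2 end).
congr (_ *m _); apply/matrixP => i j; rewrite [RHS]mxE.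
  by case: insubP => [u _ ->//|] /=; rewrite negbK => /eqP ->; rewrite mxE.
case: insubP => [u _ ->//|] /=; rewrite negbK => /codomP[l ->].
have -> : B i (g l) = colsub g B i l by rewrite [RHS]mxE.
rewrite -mulmx_colsub (_ : colsub g (rowsub f a) = mxsub f g a).
  by rewrite mulVmx // mxE (inj_eq injg) eq_sym.
by apply/matrixP => s t; rewrite !mxE.
Qed.

(** In [B] the [m.+1] columns of [g] are fixed, which leaves [n - m] of them; in [C] one entry per
    row is fixed, which leaves [m]. *)
Lemma card_chart_parameters : injective g ->
  #|chart_parameters| = (m.+1 * (n - m) + k * m)%N.
Proof.
move=> injg; rewrite card_sum !card_sig addnC; congr addn.
  rewrite (@eq_card _ _ [predX 'I_m.+1 & [predC (mem (codom g))]]) => [|[j u]].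
    rewrite cardX card_ord; congr muln; have := cardC (mem (codom g)).
    by rewrite (card_codom injg) !card_ord => /(canRL (addKn _)) ->; rewrite subSS.
  by rewrite !inE.
pose free_entry := [pred x : 'I_k * 'I_m.+1 | x.2 != jj x.1].
have cardC_free : #|[predC free_entry]| = k.
  have inj_jj : injective (fun i => (i, jj i)) by move=> i j [].
  rewrite -[RHS](card_ord k) -(card_codom inj_jj); apply: eq_card => -[i j].
  rewrite !inE /= negbK; apply/eqP/codomP => [->|[i' [-> ->]]//].
  by exists i.
have := cardC free_entry; rewrite cardC_free card_prod !card_ord mulnSr.
by move=> /eqP; rewrite eqn_add2r => /eqP.
Qed.

End Chart.

Lemma separated_chain_length (F : fieldType) (n k m : nat)
    (M : set (unordered_hyperplanes F n k)) (l : nat)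
    (E : nat -> set (hyperplanes F n k)) :
  (m < k)%N -> (m <= n)%N ->
  (forall H, M (orbit_of H) -> generic_tuple m H) ->
  separated_chain M l E -> (l <= m.+1 * (n - m) + k * m)%N.
Proof.
move=> lt_mk le_mn MG [hE sE sepE].
have [[[H0 EH0] _] ME0] := hE 0%N isT.
have [a0 Ha0] := coordinates_exist H0.
have ra0 := generic_tuple_rank lt_mk le_mn (MG _ (ME0 _ EH0)) Ha0.
(* The minor and the normalized entries are chosen at a point of the smallest member, so that this
   chart meets every member of the chain. *)
have [f [g [injg uG0]]] := exists_invertible_minor ra0.
(* A row vanishing in all columns of [g] would be zero by the factorization. *)
have jj_ex i : exists j, a0 i (g j) != 0.
  apply/existsP; apply: contraT => /existsPn ai0.
  have /eqP := (Ha0 i).1; case; rewrite (minor_factorization ra0 uG0) row_mul.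
  rewrite (_ : row i _ = 0) ?mul0mx //; apply/rowP => j; rewrite !mxE.
  by apply/eqP; have := ai0 j; rewrite negbK.
pose jj i := projT1 (cid (jj_ex i)).
have a0jj i : a0 i (g (jj i)) != 0 := projT2 (cid (jj_ex i)).
pose t i := g (jj i).
pose delta : multipoly F n k :=
  \det (\matrix_(i, j) mpolyX F (mnm1 (mxvec_index (f i) (g j)))).
pose N i := normalized_coordinates t delta (E i).
have [b0 Hb0 b01] := coordinates_normalize Ha0 a0jj.
have Nb0 : N 0%N b0.
  exists H0 => //; split=> //; rewrite eval_at_det -unitfE -[_ \is a _]/(_ \in unitmx).
  have [c c0 bE] := coordinates_unique Ha0 Hb0.
  have -> : mxsub f g b0 = diag_mx (\row_i c (f i)) *m mxsub f g a0.
    by rewrite mul_diag_mx; apply/matrixP => i j; rewrite !mxE bE.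
  rewrite unitmx_mul uG0 andbT unitmxE det_diag unitfE.
  by apply/prodf_neq0 => i _; rewrite mxE.
have N0 i : (i <= l)%N -> N i b0.
  elim: i => // i IH il; have [H EH HN] := IH (ltnW il).
  by exists H => //; exact: sE.
have sepN i : {p | (i < l)%N -> vanishes_on (N i) p /\ ~ vanishes_on (N i.+1) p}.
  apply/cid; have [il|li] := ltnP i l; last by exists 0.
  have [p [H [hp Ep EH nH]]] := sepE i il; exists p => _; split.
    by move=> a [K /Ep EK [Ka _ _]]; exact: EK Ka.
  have [irrE _] := hE i.+1 il.
  have [|a Na /eqP pa] :=
    irreducible_normalized_nonzero (t := t) (delta := delta) irrE hp EH nH.
    by exists b0; exact: N0.
  by move=> /(_ a Na).
rewrite -(card_chart_parameters jj injg).
apply: (@prime_chain_length _ _ _ _ (@chart F n k m g jj) _ N (fun i => projT1 (sepN i))).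
- exact: chart_polynomial.
- move=> a [H EH [Ha a1 d0]]; apply: (@chart_surjective _ _ _ _ _ _ f) => //.
    have [_ MEl] := hE l (leqnn l).
    exact: generic_tuple_rank lt_mk le_mn (MG _ (MEl _ EH)) Ha.
  by rewrite unitmxE unitfE -eval_at_det.
- by exists b0.
- by move=> i il a [H EH HN]; exists H => //; exact: sE.
- move=> i il p q pq0; have [irrE _] := hE i il.
  exact: irreducible_normalized_prime irrE pq0.
- by move=> i il; have [] := projT2 (sepN i) il.
- by move=> i il; have [] := projT2 (sepN i) il.
Qed.

(** * The flag of parameters and the lower bound *)

Lemma poly_nonroot (F : numFieldType) (P : {poly F}) : P != 0 -> exists e, P.[e] != 0.
Proof.
move=> P0; apply: contrapT => /forallNP noex.
have allr : all (root P) [seq i%:R | i <- iota 0 (size P)].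
  by apply/allP => _ /mapP[i _ ->]; apply/negPn/negP; exact: noex.
have uniqr : uniq [seq i%:R : F | i <- iota 0 (size P)].
  by rewrite map_inj_uniq ?iota_uniq // => i j /eqP; rewrite eqr_nat => /eqP.
by have := max_poly_roots P0 allr uniqr; rewrite size_map size_iota ltnn.
Qed.

(** * Polynomial dependence on one parameter *)

Section PolynomialPaths.
Context (F : fieldType).
Implicit Types (h : F -> F).

Definition polynomial_path h := exists P : {poly F}, forall e, h e = P.[e].

Lemma polynomial_path_const c : polynomial_path (fun=> c).
Proof. by exists c%:P => e; rewrite hornerC. Qed.

Lemma polynomial_path_affine c c' : polynomial_path (fun e => c + e * c').
Proof. by exists (c%:P + 'X * c'%:P) => e; rewrite !hornerE. Qed.

Lemma polynomial_pathM h h' : polynomial_path h -> polynomial_path h' ->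
  polynomial_path (fun e => h e * h' e).
Proof. by move=> [P hE] [P' hE']; exists (P * P') => e; rewrite hornerM hE hE'. Qed.

Lemma polynomial_pathX h k : polynomial_path h -> polynomial_path (fun e => h e ^+ k).
Proof. by move=> [P hE]; exists (P ^+ k) => e; rewrite horner_exp hE. Qed.

Lemma polynomial_path_sum (I : Type) (r : seq I) (Q : pred I) (h : I -> F -> F) :
  (forall i, polynomial_path (h i)) ->
  polynomial_path (fun e => \sum_(i <- r | Q i) h i e).
Proof.
move=> ph; exists (\sum_(i <- r | Q i) projT1 (cid (ph i))) => e.
by rewrite horner_sum; apply: eq_bigr => i _; rewrite -(projT2 (cid (ph i))).
Qed.

Lemma polynomial_path_prod (I : Type) (r : seq I) (Q : pred I) (h : I -> F -> F) :
  (forall i, polynomial_path (h i)) ->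
  polynomial_path (fun e => \prod_(i <- r | Q i) h i e).
Proof.
move=> ph; exists (\prod_(i <- r | Q i) projT1 (cid (ph i))) => e.
by rewrite horner_prod; apply: eq_bigr => i _; rewrite -(projT2 (cid (ph i))).
Qed.

Lemma polynomial_path_eq h h' : h =1 h' -> polynomial_path h -> polynomial_path h'.
Proof. by move=> hh' [P hE]; exists P => e; rewrite -hh'. Qed.

Lemma polynomial_path_eval (n k : nat) (p : multipoly F n k)
    (a : F -> 'M[F]_(k, n.+1)) :
  (forall i j, polynomial_path (fun e => a e i j)) ->
  polynomial_path (fun e => eval_at (a e) p).
Proof.
move=> pa; apply: (@polynomial_path_eq (fun e => \sum_(m <- msupp p)
    mcoeff m p * \prod_i \prod_j a e i j ^+ m (mxvec_index i j))).
  move=> e; rewrite [in RHS](mpolyE p) eval_at_sum; apply: eq_bigr => m _.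
  by rewrite eval_atZ eval_at_mpolyX.
apply: polynomial_path_sum => m; apply: polynomial_pathM.
  exact: polynomial_path_const.
apply: polynomial_path_prod => i; apply: polynomial_path_prod => j.
exact/polynomial_pathX/pa.
Qed.

Lemma polynomial_path_det (r : nat) (a : F -> 'M[F]_r) :
  (forall i j, polynomial_path (fun e => a e i j)) ->
  polynomial_path (fun e => \det (a e)).
Proof.
move=> pa; apply: polynomial_path_sum => s; apply: polynomial_pathM.
  exact: polynomial_path_const.
by apply: polynomial_path_prod => i; exact: pa.
Qed.

End PolynomialPaths.

Section CoordinateHyperplanes.
Context (F : fieldType) (n k : nat).

Lemma kernel_space_dim (p : nat) (M : 'M[F]_(p, n.+1)) :
  exists2 U : {vspace 'rV[F]_n.+1}, \dim U = (n.+1 - \rank M)%N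
    & forall x, (x \in U) = (x *m M^T == 0).
Proof.
exists (lker (linfun (mulmxr M^T))) => [|x]; last by rewrite memv_ker lfunE.
rewrite -(mxrank_tr M) -mxrank_ker; apply: dim_row_space => x.
by rewrite memv_ker lfunE; apply/eqP/sub_kermxP.
Qed.

Lemma coordinates_of_matrix (a : 'M[F]_(k, n.+1)) : (forall i, row i a != 0) ->
  exists H : hyperplanes F n k, coordinates H a.
Proof.
move=> a0; have hyp i : exists K : hyperplane F n,
    forall x, (x \in hyp_space K) = (x *m (row i a)^T == 0).
  have [U dU UE] := kernel_space_dim (row i a).
  have dimU : \dim U == n by rewrite dU rank_rV a0 subn1.
  by exists (Hyperplane dimU).
exists [ffun i => projT1 (cid (hyp i))] => i; split=> // x.
by rewrite ffunE (projT2 (cid (hyp i))).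
Qed.

End CoordinateHyperplanes.

Section LowerBound.
Context (F : numFieldType) (n k m : nat) (lt_mk : (m < k)%N) (le_mn : (m <= n)%N).

(** One chart is enough here: the identity block sits in the first [m.+1] columns of [B], and the
    first column of [C] consists of ones, as in a Vandermonde matrix. *)
Let g : 'I_m.+1 -> 'I_n.+1 := @widen_ord m.+1 n.+1 le_mn.
Let jj : 'I_k -> 'I_m.+1 := fun=> ord0.
Let T := chart_parameters g jj.
Implicit Types (y : T -> F) (e : F).

Let injg : injective g.
Proof. by move=> i j /(congr1 val) ij; exact: val_inj. Qed.

Definition nondegenerate y := forall f : 'I_m.+1 -> 'I_k,
  injective f -> \det (rowsub f (chart_left y)) != 0.

Lemma chart_left0 y i : chart_left y i ord0 = 1.
Proof. by rewrite mxE; case: insubP => //= u; rewrite eqxx. Qed.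

Lemma chart_right_colsub y : colsub g (chart_right y) = 1%:M.
Proof.
apply/matrixP => i j; rewrite !mxE; case: insubP => [u /=|_].
  by rewrite codom_f.
by rewrite (inj_eq injg) eq_sym.
Qed.

Lemma chart_colsub y : colsub g (chart y) = chart_left y.
Proof. by rewrite -mulmx_colsub chart_right_colsub mulmx1. Qed.

Lemma chart_normalized y i : chart y i (g ord0) = 1.
Proof. by rewrite -(chart_left0 y i) -chart_colsub [RHS]mxE. Qed.

Lemma chart_hyperplanes y : exists H : hyperplanes F n k, coordinates H (chart y).
Proof.
apply: coordinates_of_matrix => i; apply/eqP => /rowP/(_ (g ord0)).
by rewrite [LHS]mxE [RHS]mxE chart_normalized => /eqP; rewrite oner_eq0.
Qed.

(** Any [m.+1] rows of [C] form an invertible matrix, so the corresponding hyperplanes cut out the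
    kernel of [B], independently of the choice. *)
Lemma chart_generic y H :
  nondegenerate y -> coordinates H (chart y) -> generic_tuple m H.
Proof.
move=> ndy Hy; have [Omega dimO OmegaE] := kernel_space_dim (chart_right y).
apply: (@generic_tuple_of_axis _ _ _ _ _ Omega) => //.
  suff rB : \rank (chart_right y) = m.+1 by rewrite dimO rB subSS.
  apply/eqP; rewrite eqn_leq rank_leq_row /=.
  rewrite -[X in (X <= _)%N](mxrank1 F) -(chart_right_colsub y).
  by rewrite -[X in colsub g X]mulmx1 -mulmx_colsub mxrankM_maxl.
move=> I cI; pose f i := enum_val (cast_ord (esym cI) i).
have injf : injective f by move=> i j /enum_val_inj/cast_ord_inj.
have CfE : rowsub f (chart y) = rowsub f (chart_left y) *m chart_right y.
  by rewrite mul_rowsub_mx.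
have uC : (rowsub f (chart_left y))^T \in unitmx.
  by rewrite unitmx_tr unitmxE unitfE ndy.
apply/vspaceP => x; rewrite OmegaE.
apply/(mem_tuple_intersection_coordinates _ _ Hy)/eqP => [xI|x0 i _].
  have : x *m (rowsub f (chart y))^T = 0.
    by apply/mul_row_trmx_eq0 => i; rewrite row_rowsub; apply: xI; exact: enum_valP.
  rewrite CfE trmx_mul mulmxA => /(congr1 (mulmx^~ (invmx (rowsub f (chart_left y))^T))).
  by rewrite mulmxK // mul0mx.
have : x *m (chart y)^T = 0 by rewrite trmx_mul mulmxA x0 mul0mx.
by move=> /mul_row_trmx_eq0.
Qed.

Definition line y y' e : T -> F := fun t => y t + e * (y' t - y t).

Lemma chart_left_path y y' i j :
  polynomial_path (fun e => chart_left (line y y' e) i j).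
Proof.
apply: (@polynomial_path_eq _ (fun e =>
  if insub (i, j) is Some u then line y y' e (inl u) else 1)).
  by move=> e; rewrite mxE.
case: insub => [u|]; [exact: polynomial_path_affine|exact: polynomial_path_const].
Qed.

Lemma chart_path y y' i j : polynomial_path (fun e => chart (line y y' e) i j).
Proof.
pose h l e := chart_left (line y y' e) i l * chart_right (line y y' e) l j.
apply: (@polynomial_path_eq _ (fun e => \sum_l h l e)); first by move=> e; rewrite mxE.
apply: polynomial_path_sum => l; apply: polynomial_pathM; first exact: chart_left_path.
apply: (@polynomial_path_eq _ (fun e =>
  if insub (l, j) is Some w then line y y' e (inr w) else (j == g l)%:R)).
  by move=> e; rewrite mxE.
case: insub => [u|]; [exact: polynomial_path_affine|exact: polynomial_path_const].
Qed.

(** [Q] is the product of the maximal minors along the line; each is a polynomial in [e] that is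
    nonzero at [e = 0]. *)
Lemma nondegenerate_path y y' : nondegenerate y ->
  exists2 Q : {poly F}, Q != 0 & forall e, Q.[e] != 0 -> nondegenerate (line y y' e).
Proof.
move=> ndy.
have hQ (f : {ffun 'I_m.+1 -> 'I_k}) :
    polynomial_path (fun e => \det (rowsub f (chart_left (line y y' e)))).
  apply: polynomial_path_det => i j.
  apply: polynomial_path_eq (chart_left_path y y' (f i) j) => e.
  by rewrite [RHS]mxE.
have lineE0 : line y y' 0 = y by apply/funext => t; rewrite /line mul0r addr0.
exists (\prod_(f : {ffun 'I_m.+1 -> 'I_k} | injectiveb f) projT1 (cid (hQ f))).
  apply/prodf_neq0 => f /injectiveP injf.
  apply: contraTneq (ndy f injf) => Q0.
  by rewrite -{1}lineE0 (projT2 (cid (hQ f))) Q0 horner0 eqxx.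
move=> e; rewrite horner_prod => /prodf_neq0 Qe f injf.
have eqf : [ffun i => f i] =1 f by move=> i; rewrite ffunE.
rewrite -(eq_rowsub _ eqf) (projT2 (cid (hQ [ffun i => f i]))); apply: Qe.
by apply/injectiveP => i j; rewrite !ffunE => /injf.
Qed.

(** [C] becomes the Vandermonde matrix with nodes 0, ..., k-1, whose column of ones holds the zeroth
    powers. The nodes are distinct in characteristic zero, so no maximal minor vanishes. *)
Definition vandermonde_parameters : T -> F := fun t =>
  if t is inl u then ((val u).1 : nat)%:R ^+ (val u).2 else 0.

Lemma vandermonde_nondegenerate : nondegenerate vandermonde_parameters.
Proof.
move=> f injf; pose a : 'rV[F]_m.+1 := \row_i (f i : nat)%:R.
have -> : rowsub f (chart_left vandermonde_parameters) = (Vandermonde m.+1 a)^T.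
  apply/matrixP => i j; rewrite !mxE; case: insubP => [u _ uE|] /=.
    by rewrite /vandermonde_parameters uE.
  by rewrite negbK => /eqP ->; rewrite expr0.
rewrite det_tr det_Vandermonde; apply/prodf_neq0 => i _; apply/prodf_neq0 => j ij.
rewrite !mxE subr_eq0 eqr_nat; apply: contraTneq ij => /val_inj/injf->.
by rewrite ltnn.
Qed.

(* The entries of B come first, while C is still frozen at an invertible
   Vandermonde block, so that they are linear in the entries of C * B. *)
Definition parameter_flag : seq T :=
  [seq inr w | w <- enum {: {x : 'I_m.+1 * 'I_n.+1 | x.2 \notin codom g}}] ++
  [seq inl u | u <- enum {: {x : 'I_k * 'I_m.+1 | x.2 != jj x.1}}].

Let size_flag : size parameter_flag = #|T|.
Proof. by rewrite size_cat !size_map card_sum addnC !cardT !enumT. Qed.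

Let index_inr_inl w u : (index (inr w) parameter_flag < index (inl u) parameter_flag)%N.
Proof.
have inr_in : inr w \in [seq inr w : T | w <-
    enum {: {x : 'I_m.+1 * 'I_n.+1 | x.2 \notin codom g}}].
  by apply/mapP; exists w; rewrite ?mem_enum.
rewrite !index_cat inr_in ifN; last by apply/negP => /mapP[].
by rewrite ltn_addr // index_mem.
Qed.

Let y0 := vandermonde_parameters.

Definition flag_space (s : nat) : set (T -> F) :=
  [set y | forall t, (s <= index t parameter_flag)%N -> y t = y0 t].

Definition flag_locus (s : nat) : set (hyperplanes F n k) :=
  [set H | exists y, [/\ flag_space s y, nondegenerate y & coordinates H (chart y)]].

Lemma flag_space_line s y y' e :
  flag_space s y -> flag_space s y' -> flag_space s (line y y' e).
Proof. by move=> ys ys' t st; rewrite /line ys // ys' // subrr mulr0 addr0. Qed.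

(** Join a point outside [Z1] to a point outside [Z2] by a line of parameters. A general point of
    the line is nondegenerate and avoids both separating polynomials, so it lies in the locus but in
    neither closed set. *)
Lemma flag_locus_irreducible s : irreducible (flag_locus s).
Proof.
split.
  have [H Hy] := chart_hyperplanes y0.
  by exists H, y0; split=> //; exact: vandermonde_nondegenerate.
move=> Z1 Z2 cZ1 cZ2 cov; apply: contrapT => /not_orP[].
move=> /existsNP[H1 /not_implyP[[y1 [ys1 nd1 Hy1]] nZ1]].
move=> /existsNP[H2 /not_implyP[[y2 [ys2 nd2 Hy2]] nZ2]].
have [p1 [hp1 Zp1 np1]] := closed_separate cZ1 nZ1.
have [p2 [hp2 Zp2 np2]] := closed_separate cZ2 nZ2.
have [P1 P1E] := polynomial_path_eval p1 (chart_path y1 y2).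
have [P2 P2E] := polynomial_path_eval p2 (chart_path y1 y2).
have [Q Q0 QE] := nondegenerate_path y2 nd1.
have line0 : line y1 y2 0 = y1 by apply/funext => t; rewrite /line mul0r addr0.
have line1 : line y1 y2 1 = y2 by apply/funext => t; rewrite /line mul1r addrC subrK.
have [e] : exists e, (P1 * P2 * Q).[e] != 0.
  apply: poly_nonroot; rewrite !mulf_neq0 //.
    apply/eqP => P10; apply: np1; apply/(zero_locus1 Hy1 hp1).
    by rewrite -line0 P1E P10 horner0.
  apply/eqP => P20; apply: np2; apply/(zero_locus1 Hy2 hp2).
  by rewrite -line1 P2E P20 horner0.
rewrite !hornerM !mulf_eq0 !negb_or -andbA => /and3P[/eqP e1 /eqP e2 /QE nde].
have [H He] := chart_hyperplanes (line y1 y2 e).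
have [|/Zp1|/Zp2] := cov H.
- by exists (line y1 y2 e); split=> //; exact: flag_space_line.
- by rewrite (zero_locus1 He hp1) P1E => /e1.
- by rewrite (zero_locus1 He hp2) P2E => /e2.
Qed.

(** An entry of [C] is itself an entry of [C * B], in a column of [g]. When an entry of [B] is
    freed, [C] is still constant, so [B] is a fixed inverse times rows of [C * B]. *)
Lemma flag_coordinate t : exists p, forall y,
  flag_space (index t parameter_flag).+1 y -> eval_at (chart y) p = y t - y0 t.
Proof.
case: t => [u|w].
  exists (mpolyX F (mnm1 (mxvec_index (val u).1 (g (val u).2))) -
    y0 (inl u) *: 1) => y _.
  rewrite eval_atD -scaleNr eval_atZ eval_at1 mulr1 eval_at_var.
  have -> : chart y (val u).1 (g (val u).2) = chart_left y (val u).1 (val u).2.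
    by rewrite -[in RHS]chart_colsub [RHS]mxE.
  by rewrite mxE -surjective_pairing valK.
pose f : 'I_m.+1 -> 'I_k := widen_ord lt_mk.
have injf : injective f by move=> i j /(congr1 val) ij; exact: val_inj.
pose C := rowsub f (chart_left y0).
have uC : C \in unitmx by rewrite unitmxE unitfE vandermonde_nondegenerate.
pose j := (val w).1; pose v := (val w).2.
exists (\sum_i invmx C j i *: mpolyX F (mnm1 (mxvec_index (f i) v))) => y ys.
have leftE : chart_left y = chart_left y0.
  apply/matrixP => i l; rewrite !mxE; case: insubP => // u _ _.
  exact/ys/index_inr_inl.
have -> : y (inr w) - y0 (inr w) = chart_right y j v.
  by rewrite subr0 mxE -surjective_pairing valK.
rewrite -[chart_right y](mulKmx uC) mxE eval_at_sum; apply: eq_bigr => i _.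
rewrite eval_atZ eval_at_var; congr (_ * _).
by rewrite /C -leftE mul_rowsub_mx [RHS]mxE.
Qed.

Lemma flag_chain (M : set (unordered_hyperplanes F n k)) :
  (forall H, generic_tuple m H -> M (orbit_of H)) ->
  separated_chain M (m.+1 * (n - m) + k * m)%N flag_locus.
Proof.
move=> GM; rewrite -(card_chart_parameters jj injg); split.
- move=> s _; split; first exact: flag_locus_irreducible.
  by move=> H [y [_ ndy Hy]]; apply: GM; exact: chart_generic Hy.
- move=> s _ H [y [ys ndy Hy]]; exists y; split=> // t st.
  by apply: ys; exact: ltnW.
move=> s; rewrite -size_flag => s_lt.
have [t ts] : exists t, index t parameter_flag = s.
  have t0 : T by case: parameter_flag s_lt => [|t].
  exists (nth t0 parameter_flag s); apply: index_uniq => //.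
  rewrite cat_uniq !map_inj_uniq -?enumT ?enum_uniq; try by move=> ? ? [].
  rewrite andbT /=; apply/hasPn => _ /mapP[u _ ->]; by apply/negP => /mapP[].
have [p pE] := flag_coordinate t; rewrite ts in pE.
(* Moving from [y0] towards [y1] changes only the newly freed parameter, by [e]. *)
pose y1 : T -> F := fun t' => y0 t' + (t' == t)%:R.
have [Q Q0 QE] := nondegenerate_path y1 vandermonde_nondegenerate.
(* The factor ['X] ensures that [e] is nonzero, so the new point really leaves the previous
   locus. *)
have [e] := poly_nonroot (mulf_neq0 Q0 (negbT (polyX_eq0 F))).
rewrite hornerM hornerX mulf_eq0 negb_or => /andP[/QE nde e0].
have [H He] := chart_hyperplanes (line y0 y1 e).
have les : flag_space s.+1 (line y0 y1 e).
  move=> t'; rewrite /line /y1 addrAC subrr add0r; case: eqP => [->|_ _].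
    by rewrite ts ltnn.
  by rewrite mulr0 addr0.
have hm := @homogenization_multihomogeneous _ _ _ (fun=> g ord0) p.
exists (homogenization (fun=> g ord0) p), H; split => //.
- move=> K [y [ys ndy Ky]]; apply/(zero_locus1 Ky hm).
  rewrite eval_homogenization; last exact: chart_normalized.
  by rewrite pE ?ys ?subrr ?ts // => t' /ltnW; exact: ys.
- by exists (line y0 y1 e).
rewrite (zero_locus1 He hm) eval_homogenization; last exact: chart_normalized.
rewrite pE // /line /y1 eqxx; rewrite addrAC subrr add0r addrAC subrr add0r mulr1.
exact/eqP.
Qed.

End LowerBound.

(** * The dimension of the moduli space *)

Lemma moduli_space_dimension (F : numFieldType) (n d : nat)
    (A : {fset hyperplane F n}) : coned_generic d A ->
  has_dimension (set_type (moduli_space A))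
    (d.+1 * (n - d) + #|` A| * (n - d - 1))%N.
Proof.
move=> cA; have [m [nE m0 lt_mk genA]] := coned_generic_tuple cA.
have [H0 AH0] := ordering_exists A; have gH0 := genA _ AH0.
have n0 : (0 < n)%N by rewrite nE addnS.
have le_mn : (m <= n)%N by rewrite nE leq_addr.
have nd : (n - d = m.+1)%N by rewrite nE addnS -addSn addnK.
have nm : (n - m = d.+1)%N by rewrite nE addKn.
(* Since [m = n - d - 1], the factors [d.+1] and [n - d] are [n - m] and [m.+1] in the opposite
   order. *)
have DE : (d.+1 * (n - d) + #|` A| * (n - d - 1) =
    m.+1 * (n - m) + #|` A| * m)%N.
  by rewrite nd nm subn1 mulnC.
have MG H : moduli_space A (orbit_of H) <-> generic_tuple m H.
  exact: moduli_space_generic m0 n0 AH0 gH0.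
rewrite DE; split=> [|l Z /irreducible_chain_lift[E]].
  by apply: separated_chain_orbits; apply: flag_chain => // H /MG.
by apply: separated_chain_length => // H /MG.
Qed.

Theorem lemma21 (R : realType) (n d k : nat) (A : {fset hyperplane R[i] n}) :
  #|` A|%fset = k ->
  coned_generic d A ->
  has_dimension (set_type (moduli_space A))
    (d.+1 * (n - d) + k * (n - d - 1))%N.
Proof. by move=> <-; exact: moduli_space_dimension. Qed.
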